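(* Let $\alpha\in\mathbb{N}$, $\rho\in\mathcal{S}_+^{\rm mon}$, $f\in W^{\alpha,2}_\rho(\mathbb{R})$, and let $g=((f\rho)\circ\phi)\,\phi'$ on $(0,2\pi)$. Then: For $\tau=0,\dots,\alpha$, $$\big\|g^{(\tau)}\big\|_{L^2(0,2\pi)}\le C_{\rho,\tau}\,\|f\|_{W^{\alpha,2}_\rho(\mathbb{R})},$$ where the constant $C_{\rho,\tau}>0$ is independent of $f$. Moreover, for $\tau=0,\dots,\alpha-1$, $$\lim_{\theta\to0^+}g^{(\tau)}(\theta)=\lim_{\theta\to2\pi^-}g^{(\tau)}(\theta)=0.$$ In consequence, $g\in W^{\alpha,2}_{\rm per}(0,2\pi)$.
   Context: $\mathbb{N}=\{1,2,\dots\}$, $\mathbb{N}_0=\mathbb{N}\cup\{0\}$. Monotonic Schwartz weights: $\mathcal{S}$ is the Schwartz space of $\omega\in C^\infty(\mathbb{R})$ with $\sup_{x\in\mathbb{R}}|x^a\omega^{(b)}(x)|<\infty$ for all $a,b\in\mathbb{N}_0$. $\mathcal{S}_+^{\rm mon}$ is the set of real-valued $\omega\in\mathcal{S}$ with $\omega(x)>0$ for all $x\in\mathbb{R}$ for which there exists $K>0$ such that $x\,\omega'(x)\le 0$ for all $x\in\mathbb{R}\setminus[-K,K]$. Weighted Sobolev space: for $1<q<\infty$, $\alpha\in\mathbb{N}$, $W^{\alpha,q}_\rho(\mathbb{R})$ is the space of functions $f:\mathbb{R}\to\mathbb{C}$ with weak derivatives $f^{(\tau)}$, $\tau=0,\dots,\alpha$,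 and $\|f\|_{W^{\alpha,q}_\rho(\mathbb{R})}=\big(\sum_{\tau=0}^\alpha\int_{\mathbb{R}}|f^{(\tau)}(x)|^q\rho(x)\,dx\big)^{1/q}<\infty$. The continuous representative of $f$ is always used. Periodic Sobolev space: $W^{\alpha,q}_{\rm per}(0,2\pi)$ is the set of $g\in L^q(0,2\pi)$ with weak derivatives on $(0,2\pi)$ (test functions $C_c^\infty(0,2\pi)$) satisfying $\sum_{\tau=0}^\alpha\int_0^{2\pi}|g^{(\tau)}(\theta)|^q\,d\theta<\infty$ and $g^{(\tau)}(0)=g^{(\tau)}(2\pi)$ for $\tau=0,\dots,\alpha-1$ (endpoint values of the continuous representatives on $[0,2\pi]$). Möbius transformation: fix $c>0$ (constants may depend on $c$) and let $\phi:(0,2\pi)\to\mathbb{R}$, $\phi(\theta)=-c\cot(\theta/2)$, so $\phi'(\theta)=\frac{c}{2\sin^2(\theta/2)}$. Here $g^{(\tau)}$ denotes the weak derivative on $(0,2\pi)$; for $\tau\le\alpha-1$ its continuous representative is used. *)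

(* Defs.v *)
From HB Require Import structures.
From mathcomp Require Import all_boot all_order all_algebra.
From mathcomp Require Import all_classical all_reals all_analysis.
From mathcomp Require Import complex.

Set Implicit Arguments.
Unset Strict Implicit.
Unset Printing Implicit Defensive.

Import Order.TTheory GRing.Theory Num.Theory.
Import numFieldNormedType.Exports.

Local Open Scope ring_scope.
Local Open Scope classical_set_scope.
Local Open Scope complex_scope.

(* [R[i]] carries the topology of its modulus. *)
HB.instance Definition _ (R : realType) :=
  NormedModule.copy R[i] (R[i] : numFieldType)^o.

Section Definitions.
Context {R : realType}.
Implicit Types (U : set R) (n alpha : nat) (q c : R).

Local Notation mu := (@lebesgue_measure R).
Local Notation normc := ComplexField.Normc.normc.

Definition smooth (w : R -> R) : Prop :=
  forall n x, derivable (derive1n n w) x 1.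

Definition schwartz (w : R -> R) : Prop :=
  smooth w /\
  forall a b : nat, exists M : R, forall x, `|x ^+ a * derive1n b w x| <= M.

Definition schwartz_mon (w : R -> R) : Prop :=
  [/\ schwartz w,
      forall x, 0 < w x &
      exists2 K : R, 0 < K &
        forall x, x \notin `[- K, K] -> x * derive1 w x <= 0].

Definition test_fun U (psi : R -> R) : Prop :=
  smooth psi /\
  exists K : set R, [/\ compact K, K `<=` U & forall x, ~ K x -> psi x = 0].

Definition Cintegral U (f : R -> R[i]) : R[i] :=
  (\int[mu]_(x in U) complex.Re (f x)) +i* (\int[mu]_(x in U) complex.Im (f x)).

Definition Clocally_integrable U (f : R -> R[i]) : Prop :=
  locally_integrable U (fun x => complex.Re (f x)) /\
  locally_integrable U (fun x => complex.Im (f x)).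

(* [h] is a weak derivative of order [n] of [f] on the open set [U]. Real test
   functions suffice, both sides being complex linear in the test function. *)
Definition weak_deriv U n (f h : R -> R[i]) : Prop :=
  [/\ Clocally_integrable U f, Clocally_integrable U h &
      forall psi, test_fun U psi ->
        Cintegral U (fun x => f x * (derive1n n psi x)%:C) =
        (-1) ^+ n * Cintegral U (fun x => h x * (psi x)%:C)].

(* A chosen representative; it is determined on [U] only up to a null set, and
   it is the junk value 0 when [f] has no weak derivative of order [n]. *)
Definition wderiv U n (f : R -> R[i]) : R -> R[i] :=
  xget (fun=> 0) [set h | weak_deriv U n f h].

Definition Lq_norm q U (f : R -> R[i]) : \bar R :=
  ((\int[mu]_(x in U) (normc (f x) `^ q)%:E) `^ q^-1)%E.

Definition sobolev_norm alpha q (rho : R -> R) (f : R -> R[i]) : \bar R :=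
  ((\sum_(0 <= t < alpha.+1)
      \int[mu]_x (normc (wderiv setT t f x) `^ q * rho x)%:E) `^ q^-1)%E.

Definition sobolev alpha q (rho : R -> R) (f : R -> R[i]) : Prop :=
  (forall t, (t <= alpha)%N -> exists h, weak_deriv setT t f h) /\
  (sobolev_norm alpha q rho f < +oo)%E.

Definition circle_dom : set R := `]0, (2 * pi)[%classic.

Definition sobolev_per alpha q (g : R -> R[i]) : Prop :=
  [/\ measurable_fun circle_dom (fun x => complex.Re (g x)) /\
        measurable_fun circle_dom (fun x => complex.Im (g x)),
      (Lq_norm q circle_dom g < +oo)%E,
      forall t, (t <= alpha)%N -> exists h, weak_deriv circle_dom t g h,
      (\sum_(0 <= t < alpha.+1)
         \int[mu]_(x in circle_dom)
           (normc (wderiv circle_dom t g x) `^ q)%:E < +oo)%E &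
      forall t, (t < alpha)%N -> exists h : R -> R[i],
        [/\ weak_deriv circle_dom t g h,
            {within `[0, (2 * pi)], continuous h} &
            h 0 = h (2 * pi)]].

Definition cot (x : R) : R := cos x / sin x.

Definition mobius c (theta : R) : R := - c * cot (theta / 2).

Definition mobius_pullback c (rho : R -> R) (f : R -> R[i]) (theta : R) : R[i] :=
  f (mobius c theta) * (rho (mobius c theta))%:C * (derive1 (mobius c) theta)%:C.

End Definitions.

(* Main.v *)
Require Import Defs.
From HB Require Import structures.
From mathcomp Require Import all_boot all_order all_algebra.
From mathcomp Require Import all_classical all_reals all_analysis.
From mathcomp Require Import measurable_realfun.
From mathcomp Require Import complex ring lra.

(** Let kappa x = pi + 2 atan (x / c) be the inverse of the Moebius map phi. Its
derivative is 1 / p, where p = (c^2 + x^2) / (2 c) is a polynomial, and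
phi' = p o phi. The substitution t = kappa x therefore turns d/dt into p d/dx,
and formally

    g^(n) = (T_n f) o phi,    T_n f = sum over k <= n of f^(k) m_(n,k),

with m_(0,0) = p rho and m_(n+1,k) = p (m_(n,k)' + m_(n,k-1)); these are [pull]
and [pull_coef]. Every m_(n,k) is a sum of polynomials times derivatives of rho.

The estimate behind everything is [schwartz_mon_weight]:

    |rho^(j) x|^2 (1 + x^2)^N <= C rho x.

On a half-line starting at x > K monotonicity bounds rho by rho x, and rho^(2j)
decays faster than any power; the Landau inequality
|u^(j)|^2 <= C sup |u| sup |u^(2j)| on a half-line combines the two. Hence
m_(n,k)^2 <= C rho ([adm_weight]), and as kappa' is bounded, the integral of
|T_n f o phi|^2 over the circle, which is that of |T_n f|^2 kappa' over the
line, is at most a constant times the sum of the integrals of |f^(k)|^2 rho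
([pull_bound], [ge0_integral_circle]).

The same estimate makes f^(k) m_(n,k) and f^(k) m_(n,k)' integrable on the whole
line. So the integration by parts which defines the weak derivatives of f,
applied to m_(n,k) Psi with cutoffs, holds for every smooth Psi that is bounded
together with its derivative ([weak_ibp]). On the circle this reads
([circle_pull_ibp])

    int (T_n f o phi) Psi' = - int (T_(n+1) f o phi) Psi,

without any boundary condition on Psi, and three choices of Psi give the
theorem. Test functions show that T_n f o phi is the n-th weak derivative of g
([circle_pull_weak]). The constant 1 shows that T_(n+1) f o phi has integral
zero, so its primitive from 0, which vanishes at 0, also vanishes at 2 pi
([circle_pull_mean0]). The tail integral of a test function shows that this
primitive is again an n-th weak derivative of g ([primitive_circle_pull]): it
is the continuous representative, with boundary values zero.

The norm to be bounded is that of a chosen weak derivative. By the fundamental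
lemma of the calculus of variations ([test_ortho_ae]) it agrees almost
everywhere with T_n f o phi. Test functions are real, so that real and
imaginary parts are treated separately throughout. *)

Set Implicit Arguments.
Unset Strict Implicit.
Unset Printing Implicit Defensive.

Import Order.TTheory GRing.Theory Num.Theory.
Import numFieldNormedType.Exports.

Local Open Scope ring_scope.
Local Open Scope classical_set_scope.
Local Open Scope complex_scope.
Set Bullet Behavior "Strict Subproofs".

(** * Smooth functions *)

Section Smooth.
Context {R : realType}.
Implicit Types f g : R -> R.

Lemma is_derive1_derive1 f g : (forall x : R, is_derive x 1 f (g x)) -> f^`() = g.
Proof. by move=> fg; apply/funext => x; rewrite derive1E (@derive_val _ _ _ _ _ _ _ (fg x)). Qed.

Lemma is_derive1D f g (x a b : R) : is_derive x 1 f a -> is_derive x 1 g b ->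
  is_derive x 1 (fun y => f y + g y) (a + b).
Proof. by move=> fa gb; exact: (@is_deriveD _ _ _ f g x 1 a b fa gb). Qed.

Lemma is_derive1M f g (x a b : R) : is_derive x 1 f a -> is_derive x 1 g b ->
  is_derive x 1 (fun y => f y * g y) (f x * b + g x * a).
Proof. by move=> fa gb; exact: (@is_deriveM _ _ f g x 1 a b fa gb). Qed.

Lemma is_derive1N f (x a : R) : is_derive x 1 f a ->
  is_derive x 1 (fun y => - f y) (- a).
Proof. by move=> fa; exact: (@is_deriveN _ _ _ f x 1 a fa). Qed.

Lemma is_derive1V f (x a : R) : f x != 0 -> is_derive x 1 f a ->
  is_derive x 1 (fun y => (f y)^-1) (- (f x) ^- 2 * a).
Proof. by move=> f0 fa; exact: is_deriveV. Qed.

Lemma is_derive1_chain f g (x a b : R) : is_derive (g x) 1 f a ->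
  is_derive x 1 g b -> is_derive x 1 (fun y => f (g y)) (a * b).
Proof. by move=> fa gb; exact: (@is_derive1_comp _ f g x a b fa gb). Qed.

Lemma derivable_is_derive1 f (x : R) : derivable f x 1 -> is_derive x 1 f (f^`() x).
Proof. by move=> fx; rewrite derive1E; exact: derivableP. Qed.

Lemma derivable1_cts f : (forall x : R, derivable f x 1) -> continuous f.
Proof. by move=> df x; exact/differentiable_continuous/derivable1_diffP. Qed.

(** Proving closure properties of smoothness by induction on the order would
    need the Leibniz and Faa di Bruno formulas. With this principle it is
    enough to exhibit a class of functions stable under derivation. *)
Lemma smooth_coind (P : (R -> R) -> Prop) :
  (forall f, P f -> exists2 g, P g & forall x : R, is_derive x 1 f (g x)) ->
  forall f, P f -> smooth f.
Proof.
move=> PD f Pf n x.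
have {}Pf : P (derive1n n f).
  elim: n => [//|n /PD[g Pg fg]].
  by rewrite derive1nS (is_derive1_derive1 fg).
by have [g _ fg] := PD _ Pf; case: (fg x).
Qed.

Lemma smoothS f : smooth f -> smooth f^`().
Proof. by move=> sf n x; have := sf n.+1 x; rewrite derive1Sn. Qed.

Lemma smooth_derivable f (x : R) : smooth f -> derivable f x 1.
Proof. by move/(_ 0%N x). Qed.

Lemma smooth_is_derive f (x : R) : smooth f -> is_derive x 1 f (f^`() x).
Proof. by move=> /smooth_derivable fx; exact: derivable_is_derive1. Qed.

Lemma smooth_continuous f : smooth f -> continuous f.
Proof. by move=> sf; apply: derivable1_cts => x; exact: smooth_derivable. Qed.

Lemma smooth_derive1n n f : smooth f -> smooth (derive1n n f).
Proof. move=> sf; elim: n => [|n IH]; first exact: sf.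
by rewrite derive1nS; exact: smoothS. Qed.

(** The least class that contains the smooth functions and is closed under the
    four operations; it is stable under derivation, which yields all closure
    properties at once. *)
Inductive smooth_expr : (R -> R) -> Prop :=
| SmoothBase f : smooth f -> smooth_expr f
| SmoothAdd f g : smooth_expr f -> smooth_expr g -> smooth_expr (fun x => f x + g x)
| SmoothMul f g : smooth_expr f -> smooth_expr g -> smooth_expr (fun x => f x * g x)
| SmoothComp f g : smooth_expr f -> smooth_expr g -> smooth_expr (fun x => f (g x))
| SmoothInv f : (forall x, f x != 0) -> smooth_expr f ->
                smooth_expr (fun x => (f x)^-1).

Lemma smooth_cst (a : R) : smooth (fun=> a).
Proof.
apply: (@smooth_coind (fun f => exists a, f = fun=> a)); last by exists a.
by move=> _ [{}a ->]; exists (fun=> 0); [exists 0|move=> x; exact: is_derive_cst].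
Qed.

Lemma smooth_id : smooth (fun x : R => x).
Proof.
apply: (@smooth_coind (fun f => f = id \/ exists a, f = fun=> a)); last by left.
move=> _ [->|[a ->]].
  by exists (fun=> 1); [right; exists 1|move=> x; exact: is_derive_id].
exists (fun=> 0); first by right; exists 0.
by move=> x; exact: is_derive_cst.
Qed.

Lemma smooth_expr_smooth f : smooth_expr f -> smooth f.
Proof.
apply: smooth_coind => {}f.
elim => {f} [f sf|f g Sf [df Sdf fE] Sg [dg Sdg gE]|
  f g Sf [df Sdf fE] Sg [dg Sdg gE]|f g Sf [df Sdf fE] Sg [dg Sdg gE]|
  f f0 Sf [df Sdf fE]].
- exists f^`(); first exact/SmoothBase/smoothS.
  by move=> x; exact: smooth_is_derive.
- exists (fun x => df x + dg x); first exact: SmoothAdd.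
  by move=> x; exact: is_derive1D.
- exists (fun x => f x * dg x + g x * df x).
    by apply: SmoothAdd; exact: SmoothMul.
  by move=> x; exact: is_derive1M.
- exists (fun x => dg x * df (g x)).
    by apply: SmoothMul => //; exact: SmoothComp.
  move=> x; rewrite mulrC; exact: is_derive1_chain.
- exists (fun x => (- (f x)^-1 * (f x)^-1) * df x).
    apply: SmoothMul => //; apply: SmoothMul; last exact: SmoothInv.
    rewrite (_ : (fun _ => _) = fun x => (-1) * (f x)^-1); last first.
      by apply/funext => x; rewrite mulN1r.
    by apply: SmoothMul; [exact/SmoothBase/smooth_cst|exact: SmoothInv].
  move=> x; rewrite (_ : _ * _ * _ = - (f x) ^- 2 * df x); first exact: is_derive1V.
  by rewrite expr2 invfM !mulNr.
Qed.

Lemma smoothD f g : smooth f -> smooth g -> smooth (fun x => f x + g x).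
Proof. by move=> sf sg; apply/smooth_expr_smooth/SmoothAdd; exact: SmoothBase. Qed.

Lemma smoothM f g : smooth f -> smooth g -> smooth (fun x => f x * g x).
Proof. by move=> sf sg; apply/smooth_expr_smooth/SmoothMul; exact: SmoothBase. Qed.

Lemma smooth_comp f g : smooth f -> smooth g -> smooth (fun x => f (g x)).
Proof. by move=> sf sg; apply/smooth_expr_smooth/SmoothComp; exact: SmoothBase. Qed.

Lemma smoothV f : (forall x, f x != 0) -> smooth f -> smooth (fun x => (f x)^-1).
Proof. by move=> f0 sf; apply/smooth_expr_smooth/SmoothInv => //; exact: SmoothBase. Qed.

Lemma smoothN f : smooth f -> smooth (fun x => - f x).
Proof.
move=> sf; rewrite (_ : (fun _ => _) = fun x => -1 * f x).
  by apply: smoothM; [exact: smooth_cst|exact: sf].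
by apply/funext => x; rewrite mulN1r.
Qed.

Lemma smoothB f g : smooth f -> smooth g -> smooth (fun x => f x - g x).
Proof. by move=> sf sg; apply: smoothD; [exact: sf|exact: smoothN]. Qed.

Lemma smooth_antiderivative f g :
  (forall x : R, is_derive x 1 f (g x)) -> smooth g -> smooth f.
Proof.
move=> fg sg [|n] x; first by case: (fg x).
by rewrite derive1Sn (is_derive1_derive1 fg); exact: sg.
Qed.

Lemma smooth_atan : smooth (@atan R).
Proof.
refine (@smooth_antiderivative _ (fun x => (1 + x ^+ 2)^-1) _ _).
apply: smoothV => [x|]; first by rewrite gt_eqF// ltr_pwDl// sqr_ge0.
by apply: smoothD; [exact: smooth_cst|apply: smoothM; exact: smooth_id].
Qed.

(** The classical flat function exp (- 1 / x) is [flat 1]. The polynomial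
    factor q (1 / x) makes the family stable under derivation, so that
    [smooth_coind] applies. *)
Definition flat (q : {poly R}) (x : R) : R :=
  if 0 < x then q.[x^-1] * expR (- x^-1) else 0.

Lemma poly_expR_bounded (q : {poly R}) :
  exists C : R, forall y, 0 <= y -> `|q.[y] * expR (- y)| <= C.
Proof.
suff xn n : exists C : R, forall y, 0 <= y -> y ^+ n * expR (- y) <= C.
  elim/poly_ind: q => [|q c _].
    by exists 0 => y _; rewrite horner0 mul0r normr0.
  move: (q * 'X + c%:P) => {c}{}q.
  elim: (size q) {-2}q (leqnn (size q)) => {q} [q|n IH q qn].
    by rewrite leqn0 size_poly_eq0 => /eqP ->; exists 0 => y _; rewrite horner0 mul0r normr0.
  have [C CP] := xn n; have [D DP] := IH (take_poly n q) (size_take_poly _ _).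
  exists (`|q`_n| * C + D) => y y0.
  have -> : q = q`_n *: 'X^n + take_poly n q.
    apply/polyP => i; rewrite coefD coefZ coefXn coef_take_poly.
    case: (ltngtP i n) => [|ni|->]; rewrite ?mulr0 ?add0r ?mulr1 ?addr0//.
    by rewrite nth_default// (leq_trans qn).
  rewrite coefD coefZ coefXn eqxx coef_take_poly ltnn mulr1 addr0.
  rewrite hornerD hornerZ hornerXn mulrDl (le_trans (ler_normD _ _))// lerD ?DP//.
  rewrite -mulrA normrM ler_wpM2l// ger0_norm ?CP//.
  by rewrite mulr_ge0 ?exprn_ge0 ?expR_ge0.
(* For y > 1 use y^n <= y^(n+1) <= (n+1)! exp y. *)
exists (n.+1`!%:R + 1) => y y0.
have [y1|y1] := leP y 1.
  rewrite (@le_trans _ _ 1)//; last by rewrite lerDr.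
  rewrite mulr_ile1 ?exprn_ge0 ?expR_ge0 ?exprn_ile1//.
  by rewrite -expR0 ler_expR oppr_le0.
rewrite expRN ler_pdivrMr ?expR_gt0//.
have h1 := @expR_ge1Dxn R y n y0.
 rewrite (@le_trans _ _ (n.+1`!%:R * expR y))//; last first.
  by rewrite ler_pM2r ?expR_gt0// lerDl.
rewrite -ler_pdivrMl ?ltr0n ?fact_gt0// mulrC.
apply: le_trans h1; rewrite (@le_trans _ _ (y ^+ n.+1 / n.+1`!%:R))//; last by rewrite lerDr.
by rewrite ler_pM2r ?invr_gt0 ?ltr0n ?fact_gt0// exprS ler_peMl ?exprn_ge0// ltW.
Qed.

(** Quadratic decay at 0 gives derivability there, with derivative 0. *)
Lemma flat_small (q : {poly R}) : exists C : R, forall x, `|flat q x| <= C * x ^+ 2.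
Proof.
have [C CP] := poly_expR_bounded (q * 'X^2).
have C0 : 0 <= C by apply: le_trans (CP 0 _).
exists C => x; rewrite /flat; case: ifPn => x0; last first.
  by rewrite normr0 mulr_ge0// sqr_ge0.
have := CP x^-1; rewrite invr_ge0 (ltW x0) => /(_ isT).
rewrite hornerM hornerXn exprVn -mulrA mulrCA mulrC normrM.
by rewrite (ger0_norm (x := _ ^-1)) ?invr_ge0 ?sqr_ge0// ler_pdivrMr ?exprn_gt0.
Qed.

Lemma is_derive_flat (q : {poly R}) (x : R) :
  is_derive x 1 (flat q) (flat (('X^2) * (q - q^`())) x).
Proof.
have [x0|x0|->] := ltgtP x 0.
- rewrite {2}/flat ltNge (ltW x0)/=.
  apply: (@near_eq_is_derive _ _ _ (fun=> 0) (flat q)).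
  near=> y; rewrite /flat ltNge ltW//=.
  by near: y; exact: lt_nbhsl.
- rewrite {2}/flat x0.
  have x_neq0 : x != 0 by rewrite gt_eqF.
  have dV : is_derive x 1 (fun x : R => x^-1) (- x ^- 2).
    by have := is_derive1V x_neq0 (is_derive_id x 1); rewrite mulr1.
  have dq : is_derive x 1 (fun x => q.[x^-1]) (q^`().[x^-1] * - x ^- 2).
    exact: (is_derive1_chain (is_derive_poly q x^-1) dV).
  have dN : is_derive x 1 (fun x : R => - x^-1) (x ^- 2).
    by have := is_derive1N dV; rewrite opprK.
  have dE : is_derive x 1 (fun x => expR (- x^-1)) (expR (- x^-1) * x ^- 2).
    exact: (@is_derive1_chain expR (fun x : R => - x^-1) x _ _ (is_derive_expR _) dN).
  have dF : is_derive x 1 (fun x => q.[x^-1] * expR (- x^-1))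
      (('X^2 * (q - q^`())).[x^-1] * expR (- x^-1)).
    have := is_derive1M dq dE; congr is_derive.
    rewrite hornerM hornerXn hornerD hornerN -exprVn; ring.
  apply: (@near_eq_is_derive _ _ _ _ _ _ _ _ _ dF).
  near=> y; rewrite /flat ifT//.
  by near: y; exact: lt_nbhsr.
- rewrite {2}/flat ltxx.
  have [C CP] := flat_small q.
  (* At 0 the difference quotient is bounded by C |h|. *)
  have h : (fun h => h^-1 *: (flat q (h *: (1:R) + 0) - flat q 0)) @ (0:R)^' --> (0:R).
    apply/cvgr0Pnorm_lt => e e0 /=.
    near=> h.
    rewrite {2}/flat ltxx subr0 addr0 /GRing.scale/= mulr1 normrM normfV.
    have h0 : 0 < `|h| by rewrite normr_gt0; near: h; exact: nbhs_dnbhs_neq.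
    rewrite mulrC ltr_pdivrMr// (le_lt_trans (CP h))// -real_normK ?num_real// expr2 mulrA.
    rewrite ltr_pM2r//.
    rewrite (@le_lt_trans _ _ ((`|C| + 1) * `|h|))//.
      by rewrite ler_wpM2r// (le_trans (ler_norm _))// lerDl.
    rewrite mulrC -ltr_pdivlMr ?ltr_wpDl//.
    near: h; apply: dnbhs0_lt; rewrite divr_gt0// ltr_wpDl//.
  by apply: DeriveDef; [apply/cvg_ex; exists 0|exact/cvg_lim].
Unshelve. all: by end_near. Qed.

Lemma smooth_flat q : smooth (flat q).
Proof.
apply: (@smooth_coind (fun f => exists q, f = flat q)); last by exists q.
move=> _ [{}q ->]; exists (flat (('X^2) * (q - q^`()))); first by eexists.
by move=> x; exact: is_derive_flat.
Qed.

End Smooth.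
Arguments smooth_derive1n {R} n [f] _.
Arguments smooth_flat {R} q.
Arguments smooth_cst {R} a.
Arguments smooth_is_derive {R} [f] x _.

(** * Test functions *)

Section TestFunctions.
Context {R : realType}.
Implicit Types (U : set R) (psi b : R -> R).

Lemma compact_supp_bounded (K : set R) b : compact K -> continuous b ->
  (forall x, ~ K x -> b x = 0) -> exists2 M : R, 0 <= M & forall x, `|b x| <= M.
Proof.
move=> cK cb b0.
have : compact (b @` K) by apply: continuous_compact => //; exact: continuous_subspaceT.
move=> /compact_bounded[M [_ /(_ (`|M| + 1))]].
rewrite (le_lt_trans (ler_norm _)) ?ltrDl// => /(_ isT) h.
exists (`|M| + 1); first by rewrite addr_ge0.
move=> x; have [Kx|/b0 ->] := pselect (K x); first by apply: h; exists x.
by rewrite normr0 addr_ge0.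
Qed.

Lemma derive1_supp (K : set R) psi x : compact K ->
  (forall x, ~ K x -> psi x = 0) -> ~ K x -> psi^`() x = 0.
Proof.
move=> cK psi0 Kx; rewrite derive1E (@near_eq_derive _ _ _ _ (fun=> 0)) ?derive_cst//.
have oK : open (~` K) by rewrite openC; exact: compact_closed.
by have := open_nbhs_nbhs (conj oK Kx); apply: filterS => y; exact: psi0.
Qed.

Lemma test_fun_derive1 U psi : test_fun U psi -> test_fun U psi^`().
Proof.
move=> [spsi [K [cK KU psi0]]]; split; first exact: smoothS.
by exists K; split => // x Kx; exact: derive1_supp psi0 Kx.
Qed.

Lemma test_fun_bounded U psi : test_fun U psi ->
  exists2 M : R, 0 <= M & forall x, `|psi x| <= M.
Proof.
move=> [spsi [K [cK KU psi0]]]; apply: compact_supp_bounded psi0 => //.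
exact: smooth_continuous.
Qed.

End TestFunctions.

(** * The Moebius change of variables *)

Section Mobius.
Context {R : realType}.
Notation mu := (@lebesgue_measure R).
Variable (c : R).
Implicit Types x theta : R.

Definition mobius_inv x : R := pi + 2 * atan (x / c).
Definition mobius_inv' x : R := 2 * c / (c ^+ 2 + x ^+ 2).

Hypothesis hc : 0 < c.

Let den_gt0 x : 0 < c ^+ 2 + x ^+ 2.
Proof. by rewrite ltr_wpDr ?sqr_ge0// exprn_gt0. Qed.

Lemma mobius_inv'_gt0 x : 0 < mobius_inv' x.
Proof. by rewrite divr_gt0// mulr_gt0. Qed.

Lemma is_derive_mobius_inv x : is_derive x 1 mobius_inv (mobius_inv' x).
Proof.
have dl : is_derive x 1 (fun x : R => x / c) c^-1.
  have := is_derive1M (is_derive_id x 1) (is_derive_cst c^-1 x 1).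
  by rewrite mulr0 add0r mulr1.
have da : is_derive (x / c) 1 atan ((1 + (x / c) ^+ 2)^-1).
  have <- := derive1_atan (x / c).
  by apply: derivable_is_derive1; exact: derivable_atan.
have dal := @is_derive1_chain R (@atan R) (fun x : R => x / c) x _ _ da dl.
have := is_derive1D (is_derive_cst (pi:R) x 1)
  (is_derive1M (is_derive_cst (2:R) x 1) dal).
congr is_derive; rewrite add0r mulr0 addr0 /mobius_inv' expr_div_n.
by field; rewrite !gt_eqF//= exprn_gt0.
Qed.

Lemma smooth_mobius_inv : smooth mobius_inv.
Proof.
apply: smoothD; first exact: smooth_cst.
apply: smoothM; first exact: smooth_cst.
apply: (@smooth_comp _ (@atan R)); first exact: smooth_atan.
by apply: smoothM; [exact: smooth_id|exact: smooth_cst].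
Qed.

Lemma derive1_mobius_inv : mobius_inv^`() = mobius_inv'.
Proof. apply: is_derive1_derive1; exact: is_derive_mobius_inv. Qed.

Lemma smooth_mobius_inv' : smooth mobius_inv'.
Proof. by rewrite -derive1_mobius_inv; exact/smoothS/smooth_mobius_inv. Qed.

Lemma measurable_mobius_inv : measurable_fun setT mobius_inv.
Proof.
apply: continuous_measurable_fun; apply: smooth_continuous.
exact: smooth_mobius_inv.
Qed.

Lemma measurable_mobius_inv' : measurable_fun setT mobius_inv'.
Proof.
apply: continuous_measurable_fun; apply: smooth_continuous.
exact: smooth_mobius_inv'.
Qed.

Lemma mobius_inv_circle x : circle_dom (mobius_inv x).
Proof.
rewrite /circle_dom/= in_itv/= /mobius_inv.
have := atan_gtNpi2 (x / c); have := atan_ltpi2 (x / c).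
by move: (atan _) => a; lra.
Qed.

Let half_shift theta : circle_dom theta ->
  theta / 2 - pi / 2 \in `](- (pi / 2)), (pi / 2)[%R.
Proof.
rewrite /circle_dom/= in_itv/= => /andP[h0 h2].
rewrite in_itv/=; by apply/andP; split; lra.
Qed.

(** Reduces the inversion of [mobius] to that of the tangent. *)
Lemma mobius_tan theta : mobius c theta = c * tan (theta / 2 - pi / 2).
Proof.
by rewrite /mobius /cot /tan sinBpihalf cosBpihalf !mulNr mulrN.
Qed.

Lemma mobius_invK x : mobius c (mobius_inv x) = x.
Proof.
rewrite mobius_tan /mobius_inv (_ : _ - _ = atan (x / c)); last by lra.
by rewrite atanK mulrC divfK// gt_eqF.
Qed.

Lemma mobiusK theta : circle_dom theta -> mobius_inv (mobius c theta) = theta.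
Proof.
move=> /half_shift ht; rewrite mobius_tan /mobius_inv [c * _]mulrC mulfK ?gt_eqF//.
by rewrite tanK//; lra.
Qed.

Lemma mobius_inv_lt x y : (mobius_inv x < mobius_inv y) = (x < y).
Proof.
rewrite ltrD2l ltr_pM2l// (leW_mono (le_mono (@lt_atan R))) ltr_pM2r// invr_gt0//.
Qed.

Lemma sin_half_gt0 theta : circle_dom theta -> 0 < sin (theta / 2).
Proof.
rewrite /circle_dom/= in_itv/= => /andP[h0 h2].
by apply: sin_gt0_pi; apply/andP; split; lra.
Qed.

Lemma is_derive_mobius theta : circle_dom theta ->
  is_derive theta 1 (mobius c) (mobius_inv' (mobius c theta))^-1.
Proof.
move=> ht; have s0 := sin_half_gt0 ht.
have dl : is_derive theta 1 (fun x : R => x / 2) 2^-1.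
  have := is_derive1M (is_derive_id theta 1) (is_derive_cst (2:R)^-1 theta 1).
  by rewrite mulr0 add0r mulr1.
have dco := @is_derive1_chain R (@cos R) (fun x : R => x / 2) theta _ _
  (is_derive_cos (theta / 2)) dl.
have dsi := @is_derive1_chain R (@sin R) (fun x : R => x / 2) theta _ _
  (is_derive_sin (theta / 2)) dl.
have := is_derive1M (is_derive_cst (- c) theta 1)
  (is_derive1M dco (is_derive1V (lt0r_neq0 s0) dsi)).
congr is_derive; rewrite /mobius_inv' /mobius /cot mulr0 addr0.
have := cos2Dsin2 (theta / 2).
move: (cos _) (sin _) s0 => C S S0 CS.
have D0 : C ^+ 2 + S ^+ 2 != 0 by rewrite CS oner_neq0.
have S0' : S != 0 by rewrite gt_eqF.
have -> : c ^+ 2 + (- c * (C / S)) ^+ 2 = c ^+ 2 / S ^+ 2.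
  rewrite exprMn sqrrN exprMn exprVn -[X in _ = X / _]mulr1 -CS; field.
  by rewrite S0'.
have -> : C * (- S ^- 2 * (C / 2)) + S^-1 * (- S / 2) =
    - (C ^+ 2 + S ^+ 2) / (2 * S ^+ 2) by field.
by rewrite CS /cst; field; rewrite S0' gt_eqF.
Qed.

Lemma mobius_continuous : {in circle_dom, continuous (mobius c)}.
Proof.
move=> theta; rewrite inE => ht; apply/differentiable_continuous/derivable1_diffP.
by case: (is_derive_mobius ht).
Qed.

(** The image under [mobius] of the Lebesgue measure of the circle will turn
    out to be this measure. *)
Definition mobius_density (A : set (measurableTypeR R)) : \bar R :=
  (\int[mu]_(x in A) (mobius_inv' x)%:E)%E.

Let density0 : mobius_density set0 = 0%E.
Proof. by rewrite /mobius_density integral_set0. Qed.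

Let density_ge0 A : (0 <= mobius_density A)%E.
Proof.
by apply: integral_ge0 => x _; rewrite lee_fin ltW// mobius_inv'_gt0.
Qed.

Let density_sigma_additive : semi_sigma_additive mobius_density.
Proof.
move=> /= F mF tF mUF; rewrite /mobius_density/= ge0_integral_bigcup//=.
- apply: is_cvg_ereal_nneg_natsum_cond => n _ _; exact: density_ge0.
- apply/measurable_EFinP; apply: measurable_funTS; exact: measurable_mobius_inv'.
- by move=> x _; rewrite lee_fin ltW// mobius_inv'_gt0.
Qed.

HB.instance Definition _ := isMeasure.Build _ (measurableTypeR R) _
  mobius_density density0 density_ge0 density_sigma_additive.

Lemma measurable_circle_dom : measurable (circle_dom : set R).
Proof. exact: measurable_itv. Qed.

(** The push-forward of a measure requires a map that is measurable on the
    whole line; values outside [circle_dom] are charged with mass zero below. *)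
Definition mobius_circle : R -> R := mobius c \_ circle_dom.

Lemma measurable_mobius : measurable_fun circle_dom (mobius c).
Proof.
apply: open_continuous_measurable_fun; first exact: interval_open.
exact: mobius_continuous.
Qed.

Lemma measurable_mobius_circle : measurable_fun setT mobius_circle.
Proof.
apply/(measurable_restrictT _ _).1; [exact: measurable_circle_dom|].
exact: measurable_mobius.
Qed.

Lemma mobius_inv_le x y : (mobius_inv x <= mobius_inv y) = (x <= y).
Proof. by rewrite !leNgt mobius_inv_lt. Qed.

Let circle_measure : {measure set (measurableTypeR R) -> \bar R}.
Proof.
refine (pushforward (mrestr mu measurable_circle_dom)
  (mobius_circle : measurableTypeR R -> measurableTypeR R) : {measure set _ -> \bar R}).
exact: measurable_mobius_circle.
Defined.

Lemma mobius_preimage_itv a b :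
  (mobius_circle @^-1` `]a, b]) `&` circle_dom = `]mobius_inv a, mobius_inv b]%classic.
Proof.
have E t : circle_dom t -> (t \in `]mobius_inv a, mobius_inv b]%R) = (mobius_circle t \in `]a, b]%R).
  move=> ht; rewrite /mobius_circle patchE mem_set// -{1}(mobiusK ht).
  by rewrite !in_itv/= mobius_inv_lt mobius_inv_le.
apply/seteqP; split => [t [/= tab ht]|t /= tab]; first by rewrite E.
have ht : circle_dom t.
  move: tab; rewrite in_itv/= => /andP[at_ tb].
  have := mobius_inv_circle a; have := mobius_inv_circle b.
  rewrite /circle_dom/= !in_itv/= => /andP[_ b2] /andP[a0 _].
  by rewrite (lt_trans a0 at_) (le_lt_trans tb b2).
by split => //; rewrite -E.
Qed.

Let circle_measureE A : circle_measure A = mu ((mobius_circle @^-1` A) `&` circle_dom).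
Proof. by []. Qed.

Lemma mobius_density_itv a b : a < b ->
  mobius_density `]a, b] = (mobius_inv b - mobius_inv a)%:E.
Proof.
move=> ab; rewrite /mobius_density integral_itv_obnd_cbnd; last first.
  apply/measurable_EFinP; apply: measurable_funTS; exact: measurable_mobius_inv'.
rewrite (@continuous_FTC2 _ _ mobius_inv)//.
- apply: continuous_subspaceT; apply: smooth_continuous; exact: smooth_mobius_inv'.
- have cm := smooth_continuous smooth_mobius_inv.
  split; [|exact/cvg_at_right_filter/cm|exact/cvg_at_left_filter/cm].
  by move=> x _; case: (is_derive_mobius_inv x).
- by move=> x _; rewrite derive1_mobius_inv.
Qed.

(** Both measures give the mass kappa b - kappa a to the interval from a to b,
    and half-open intervals determine a Borel measure. *)
Let circle_measure_density A : measurable A -> circle_measure A = mobius_density A.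
Proof.
pose density : {measure set (measurableTypeR R) -> \bar R} := mobius_density.
apply: (@measure_unique _ R (measurableTypeR R) (@ocitv R)
  (fun k => `](- k%:R), k%:R]%classic) _ _ _ _ circle_measure density) => //.
- exact: ocitvI.
- by move=> k; exact: is_ocitv.
- rewrite -(bigcup_itvT false false); apply: eq_bigcup => // k _.
- move=> _ [[a b] _ <-] /=; have [ab|ba] := ltP a b.
    rewrite mobius_density_itv// circle_measureE mobius_preimage_itv.
    by rewrite lebesgue_measure_itv/= lte_fin mobius_inv_lt ab -EFinB.
  have -> : `]a, b]%classic = set0 by rewrite set_itv_ge// bnd_simp -leNgt.
  transitivity (0 : \bar R)%E; first exact: (measure0 circle_measure).
  exact/esym/(measure0 density).
- move=> k; rewrite circle_measureE mobius_preimage_itv lebesgue_measure_itv.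
  by case: ifP => _; rewrite ?ltry// -EFinB ltry.
Qed.

Let circle_measure_finite : fin_num_fun circle_measure.
Proof.
move=> A mA; rewrite ge0_fin_numE// circle_measureE.
apply: (@le_lt_trans _ _ (mu circle_dom)).
  apply: le_measure; rewrite ?inE//; last exact: measurable_circle_dom.
  apply: measurableI; last exact: measurable_circle_dom.
  by rewrite -[X in measurable X]setTI; exact: measurable_mobius_circle.
by rewrite lebesgue_measure_itv; case: ifP => _; rewrite ?ltry// -EFinB ltry.
Qed.

Let nu := circle_measure : set (measurableTypeR R) -> \bar R.
HB.instance Definition _ := Measure.copy nu circle_measure.
HB.instance Definition _ := Measure_isFinite.Build _ (measurableTypeR R) R nu circle_measure_finite.

Let nu_dominates : nu `<< mu.
Proof.
apply/null_content_dominatesP => A mA muA0; rewrite [nu A]circle_measure_density//.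
apply: null_set_integral => //.
apply/measurable_EFinP; apply: measurable_funTS; exact: measurable_mobius_inv'.
Qed.

Let measurable_EFin_inv' : measurable_fun setT (EFin \o mobius_inv').
Proof. apply/measurable_EFinP; exact: measurable_mobius_inv'. Qed.

Let integrable_density : mu.-integrable setT (EFin \o mobius_inv').
Proof.
apply/integrableP; split => //.
under eq_integral do rewrite gee0_abs ?lee_fin ?ltW ?mobius_inv'_gt0//=.
rewrite -/(mobius_density setT) -circle_measure_density// -ge0_fin_numE//.
exact: circle_measure_finite.
Qed.

(** The density [mobius_inv'] is almost everywhere the Radon-Nikodym
    derivative of the image measure, for which integration against a density
    is known. *)
Let integral_density (h : R -> \bar R) : (forall x, 0 <= h x)%E ->
  measurable_fun setT h ->
  (\int[nu]_x h x = \int[mu]_x (h x * (mobius_inv' x)%:E))%E.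
Proof.
move=> h0 mh.
rewrite -(Radon_Nikodym_SigmaFinite.change_of_variables nu_dominates)//.
have mf := Radon_Nikodym_SigmaFinite.f_integrable nu_dominates.
apply: ae_eq_integral => //.
- apply: emeasurable_funM => //; exact: measurable_int mf.
- by apply: emeasurable_funM.
- apply: ae_eqe_mul2l; apply: integral_ae_eq => // A _ mA.
  by rewrite -Radon_Nikodym_SigmaFinite.f_integral// circle_measure_density.
Qed.

(** The substitution t = kappa x for integrands that are only measurable: the
    weak derivatives to which it is applied have no regularity. *)
Lemma ge0_integral_circle (G : R -> \bar R) : measurable_fun circle_dom G ->
  (forall t, circle_dom t -> 0 <= G t)%E ->
  (\int[mu]_(t in circle_dom) G t =
   \int[mu]_x (G (mobius_inv x) * (mobius_inv' x)%:E))%E.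
Proof.
move=> mG G0; pose h x := G (mobius_inv x).
have mh : measurable_fun setT h.
  apply: (measurable_comp measurable_circle_dom _ mG measurable_mobius_inv).
  by move=> _ [x _ <-]; exact: mobius_inv_circle.
have h0 x : (0 <= h x)%E by apply: G0; exact: mobius_inv_circle.
rewrite -(integral_density h0 mh).
rewrite [in RHS](_ : \int[nu]_x h x = \int[circle_measure]_x h x)%E//.
have -> : (\int[circle_measure]_x h x =
    \int[mrestr mu measurable_circle_dom]_(x in mobius_circle @^-1` setT)
      (h \o mobius_circle) x)%E.
  exact: (@ge0_integral_pushforward _ _ (measurableTypeR R) (measurableTypeR R) R
    mobius_circle measurable_mobius_circle (mrestr mu measurable_circle_dom)
    setT h measurableT mh (fun x _ => h0 x)).
rewrite preimage_setT.
have mhm : measurable_fun setT (h \o mobius_circle).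
  exact: measurableT_comp measurable_mobius_circle.
have mC : measurable (~` circle_dom : set (measurableTypeR R)).
  by apply: measurableC; exact: measurable_circle_dom.
rewrite [in RHS](ge0_negligible_integral mC)//=; last first.
  by rewrite /mrestr/= setICl measure0.
rewrite setTD setCK [in RHS](eq_measure_integral mu)//=; last first.
  by move=> A mA AU; rewrite /mrestr/= (setIidl AU).
apply: eq_integral => t; rewrite inE => ht.
by rewrite /= /mobius_circle /h patchE mem_set// mobiusK.
Qed.

End Mobius.

(** * Real-valued integrable functions *)

Notation rintegrable D f := (lebesgue_measure.-integrable D (EFin \o f)).

Section RealIntegral.
Context {R : realType}.
Notation mu := (@lebesgue_measure R).
Implicit Types (D U : set (measurableTypeR R)) (f g b : R -> R).

Lemma le_rintegrable D f g : measurable D -> measurable_fun D f ->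
  (forall x, D x -> `|f x| <= g x) -> rintegrable D g -> rintegrable D f.
Proof.
move=> mD mf fg; apply: le_integrable => //; first exact/measurable_EFinP.
by move=> x Dx /=; rewrite lee_fin (le_trans (fg _ Dx))// ler_norm.
Qed.

Lemma rintegrable_measurable D f : rintegrable D f -> measurable_fun D f.
Proof. by move=> /measurable_int/measurable_EFinP. Qed.

Lemma rintegrableD D f g : measurable D -> rintegrable D f -> rintegrable D g ->
  rintegrable D (fun x => f x + g x).
Proof. by move=> mD jf jg; have := integrableD mD jf jg. Qed.

Lemma rintegrableZ D (k : R) f : measurable D -> rintegrable D f ->
  rintegrable D (fun x => k * f x).
Proof. by move=> mD jf; have := integrableZl mD k jf. Qed.

Lemma rintegrable_norm D f : rintegrable D f -> rintegrable D (fun x => `|f x|).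
Proof. by move=> /integrable_abse. Qed.

Lemma rintegrableM D f b (M : R) : measurable D -> rintegrable D f ->
  measurable_fun D b -> (forall x, D x -> `|b x| <= M) ->
  rintegrable D (fun x => f x * b x).
Proof.
move=> mD jf mb bM; apply: (@le_rintegrable _ _ (fun x => M * `|f x|)) => //.
- by apply: measurable_funM => //; exact: rintegrable_measurable.
- by move=> x Dx; rewrite normrM mulrC ler_wpM2r// bM.
- by apply: rintegrableZ => //; exact: rintegrable_norm.
Qed.

Lemma eq_rintegrable D f g : measurable D -> {in D, f =1 g} ->
  rintegrable D f -> rintegrable D g.
Proof. by move=> mD fg; apply: eq_integrable => // x xD /=; rewrite fg. Qed.

Lemma rintegrableZr D (k : R) f :
  measurable D -> rintegrable D f -> rintegrable D (fun x => f x * k).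
Proof.
move=> mD jf; apply: eq_rintegrable (rintegrableZ k mD jf) => // x _.
by rewrite mulrC.
Qed.

Lemma rintegrable_sum D n (F : nat -> R -> R) :
  measurable D -> (forall k, (k < n)%N -> rintegrable D (F k)) ->
  rintegrable D (fun x => \sum_(k < n) F k x) /\
  \int[mu]_(x in D) (\sum_(k < n) F k x) = \sum_(k < n) \int[mu]_(x in D) F k x.
Proof.
move=> mD; elim: n => [|n IH] jF.
  split.
    apply: (@eq_rintegrable _ (fun=> 0)) => //; last exact: integrable0.
    by move=> x _; rewrite big_ord0.
  rewrite big_ord0 (@eq_Rintegral _ _ _ _ _ (fun=> 0)); last first.
    by move=> x _; rewrite big_ord0.
  by rewrite Rintegral_cst// mul0r.
have [jS IS] := IH (fun k kn => jF k (ltnW kn)).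
have jn := jF n (ltnSn n).
split.
  apply: eq_rintegrable (rintegrableD mD jS jn) => // x _.
  by rewrite big_ord_recr.
rewrite big_ord_recr/= -IS -RintegralD//.
by apply: eq_Rintegral => x _; rewrite big_ord_recr.
Qed.

Lemma rintegrable_patch D f :
  measurable D -> rintegrable D f -> rintegrable setT (f \_ D).
Proof.
by move=> mD jf; rewrite -restrict_EFin; apply/integrable_restrict; rewrite ?setTI.
Qed.

Lemma rintegrableS D f :
  measurable D -> rintegrable setT f -> rintegrable D f.
Proof. by move=> mD; apply: integrableS => //; exact: subsetT. Qed.

Lemma Rintegral_dominated D (F : nat -> R -> R) f g : measurable D ->
  (forall n, measurable_fun D (F n)) ->
  (forall x, D x -> F n x @[n --> \oo] --> f x) ->
  rintegrable D g -> (forall n x, D x -> `|F n x| <= g x) ->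
  (\int[mu]_(x in D) F n x) @[n --> \oo] --> \int[mu]_(x in D) f x.
Proof.
move=> mD mF Ff jg Fg.
have mf : measurable_fun D f by exact: measurable_fun_cvg Ff.
have jf : rintegrable D f.
  apply: (le_rintegrable mD mf _ jg) => x Dx.
  have nFf : `|F n x| @[n --> \oo] --> `|f x| by apply: cvg_norm; exact: Ff.
  rewrite -(cvg_lim _ nFf)//; apply: limr_le; first by apply/cvg_ex; exists `|f x|.
  by apply: nearW => n; exact: Fg.
apply: fine_cvg; rewrite fineK; last exact: integrable_fin_num.
apply: (@dominated_cvg _ _ _ _ _ mD _ _ (EFin \o g)) => //.
- by move=> n; exact/measurable_EFinP.
- by move=> x Dx; apply: cvg_EFin; [exact: nearW|exact: Ff].
Qed.

Lemma locally_rintegrable_test U K f b : locally_integrable U f -> compact K ->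
  K `<=` U -> continuous b -> (forall x, ~ K x -> b x = 0) ->
  rintegrable U (fun x => f x * b x).
Proof.
move=> [mf oU lf] cK KU cb b0.
have mU : measurable U by exact: open_measurable.
have mK : measurable K by exact: compact_measurable.
have [M _ bM] := compact_supp_bounded cK cb b0.
have jK : rintegrable K f.
  apply/integrableP; split; last by apply: lf.
  by apply/measurable_EFinP; exact: measurable_funS mf.
have jKb : rintegrable K (fun x => f x * b x).
  apply: (@rintegrableM _ _ _ M) => //.
  by apply: measurable_funTS; exact: continuous_measurable_fun.
have : rintegrable U ((fun x => f x * b x) \_ K).
  rewrite -restrict_EFin; apply/integrable_restrict => //.
  by rewrite setIidr.
apply: eq_rintegrable => // x _; rewrite patchE; case: ifPn => //.
by rewrite notin_setE => /b0 ->; rewrite mulr0.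
Qed.

End RealIntegral.

(** * The fundamental lemma of the calculus of variations *)

Section Variations.
Context {R : realType}.
Notation mu := (@lebesgue_measure R).

(** Steepening two flat functions at the ends of an interval, instead of
    mollifying, makes the indicator of the open interval a bounded pointwise
    limit of test functions. *)
Definition bump (a b : R) (n : nat) (x : R) : R :=
  flat 1 (n.+1%:R * (x - a)) * flat 1 (n.+1%:R * (b - x)).

Lemma flat1_bound (x : R) : 0 <= flat 1 x <= 1.
Proof.
rewrite /flat; case: ifPn => [x0|_]; last by rewrite lexx ler01.
by rewrite hornerC mul1r expR_ge0/= -expR0 ler_expR oppr_le0 invr_ge0 ltW.
Qed.

Lemma flat1_cvg (x : R) : flat 1 (n.+1%:R * x) @[n --> \oo] --> (if 0 < x then 1 else 0 : R).
Proof.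
case: ifPn => x0; last first.
  rewrite (_ : (fun _ => _) = (fun=> 0)); first exact: cvg_cst.
  by apply/funext => n; rewrite /flat pmulr_rgt0// (negbTE x0).
rewrite (_ : (fun _ => _) = (fun n => expR (- (x^-1 * n.+1%:R^-1)))); last first.
  apply/funext => n; rewrite /flat pmulr_rgt0// x0 hornerC mul1r invfM.
  by rewrite [in RHS]mulrC.
have h : (- (x^-1 * n.+1%:R^-1)) @[n --> \oo] --> - (x^-1 * 0).
  by apply: cvgN; apply: cvgM; [exact: cvg_cst|exact: cvg_harmonic].
rewrite mulr0 oppr0 in h.
have := cvg_comp _ expR h (@continuous_expR R 0).
by rewrite expR0.
Qed.

Lemma bump_smooth a b n : smooth (bump a b n).
Proof.
have sc : smooth (fun=> n.+1%:R : R) by exact: smooth_cst.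
have sa : smooth (fun x : R => n.+1%:R * (x - a)).
  apply: smoothM; [exact: sc|apply: smoothB]; [exact: smooth_id|exact: smooth_cst].
have sb : smooth (fun x : R => n.+1%:R * (b - x)).
  apply: smoothM; [exact: sc|apply: smoothB]; [exact: smooth_cst|exact: smooth_id].
have fa := @smooth_comp R (flat 1) _ (smooth_flat 1) sa.
have fb := @smooth_comp R (flat 1) _ (smooth_flat 1) sb.
exact: (smoothM fa fb).
Qed.

Lemma bump_bound a b n x : `|bump a b n x| <= 1.
Proof.
have /andP[h0 h1] := flat1_bound (n.+1%:R * (x - a)).
have /andP[k0 k1] := flat1_bound (n.+1%:R * (b - x)).
by rewrite ger0_norm ?mulr_ge0// mulr_ile1.
Qed.

Lemma bump_out a b n x : x \notin `]a, b[%R -> bump a b n x = 0.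
Proof.
rewrite in_itv/= negb_and -!leNgt => /orP[h|h]; rewrite /bump /flat.
  by rewrite pmulr_rgt0// subr_gt0 ltNge h mul0r.
by rewrite [X in _ * X]ifF ?mulr0// pmulr_rgt0// subr_gt0 ltNge h.
Qed.

Lemma bump_cvg a b x : bump a b n x @[n --> \oo] --> (\1_(`]a, b[) x : R).
Proof.
have h : bump a b n x @[n --> \oo] -->
    ((if 0 < x - a then 1 else 0) * (if 0 < b - x then 1 else 0) : R).
  by apply: cvgM; exact: flat1_cvg.
move: h; rewrite !subr_gt0 indicE mem_setE in_itv/=.
by case: (a < x); case: (x < b); rewrite /= ?mulr0 ?mul0r ?mulr1.
Qed.

Lemma bump_test (U : set R) a b n : `[a, b] `<=` U -> test_fun U (bump a b n).
Proof.
move=> abU; split; first exact: bump_smooth.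
exists `[a, b]; split => //; first exact: segment_compact.
move=> x xab; apply: bump_out; by apply/negP => xab'; apply: xab; exact: subset_itv_oo_cc.
Qed.

(** Dominated convergence along the bumps of the interval. *)
Lemma test_ortho_itv (U : set R) w a b : locally_integrable U w ->
  (forall psi, test_fun U psi -> \int[mu]_(x in U) (w x * psi x) = 0) ->
  `[a, b] `<=` U -> \int[mu]_(x in `]a, b[) w x = 0.
Proof.
move=> lw ortho abU; have [mw oU lfw] := lw.
have mU : measurable U by exact: open_measurable.
have jab : rintegrable `[a, b] w.
  apply/integrableP; split; last by apply: lfw => //; exact: segment_compact.
  by apply/measurable_EFinP; exact: measurable_funS mw.
have cvgI : \int[mu]_(x in U) (w x * bump a b n x) @[n --> \oo] -->
    \int[mu]_(x in U) (w x * \1_(`]a, b[) x).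
{ apply: (@Rintegral_dominated _ _ _ _ (fun x => `|(w \_ `[a, b]) x|)) => //.
  - move=> n; apply: measurable_funM => //; apply: measurable_funTS.
    by apply: continuous_measurable_fun; apply: smooth_continuous; exact: bump_smooth.
  - by move=> x _; apply: cvgM; [exact: cvg_cst|exact: bump_cvg].
  - apply: rintegrable_norm; rewrite -restrict_EFin.
    by apply/integrable_restrict => //; rewrite setIidr.
  - move=> n x _; rewrite patchE; case: ifPn => xab.
      by rewrite normrM ler_piMr// bump_bound.
    rewrite bump_out ?mulr0 ?normr0//; apply: contra xab => xab.
    by rewrite inE; exact: subset_itv_oo_cc. }
have : \int[mu]_(x in U) (w x * bump a b n x) @[n --> \oo] --> (0 : R).
  rewrite (_ : (fun _ => _) = (fun=> 0)); first exact: cvg_cst.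
  by apply/funext => n; apply: ortho; exact: bump_test.
move=> /(cvg_unique _ cvgI) <-//.
rewrite [LHS]Rintegral_mkcond [RHS]Rintegral_mkcond; apply: eq_Rintegral => x _.
rewrite !patchE indicE; case: ifPn => xab; case: ifPn => xU; rewrite ?mulr1 ?mulr0//.
move: xU; rewrite notin_setE => -[]; apply: abU; apply: subset_itv_oo_cc.
by rewrite inE in xab.
Qed.

(** On a compact subinterval every integral of w from the left end vanishes by
    [test_ortho_itv], hence so does its derivative, which is w almost
    everywhere by Lebesgue differentiation. Countably many subintervals
    exhaust the interval. *)
Lemma test_ortho_ae (A B : R) w : locally_integrable `]A, B[ w ->
  (forall psi, test_fun `]A, B[ psi -> \int[mu]_(x in `]A, B[) (w x * psi x) = 0) ->
  {ae mu, forall x, `]A, B[%classic x -> w x = 0}.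
Proof.
move=> lw ortho; have [mw oU lfw] := lw.
pose a k : R := A + k.+1%:R^-1; pose b k : R := B - k.+1%:R^-1.
have abU k : `[a k, b k] `<=` `]A, B[.
  move=> x /=; rewrite !in_itv/= => /andP[ax xb].
  rewrite (lt_le_trans _ ax) ?ltrDl ?invr_gt0//=.
  by rewrite (le_lt_trans xb)// ltrBlDr ltrDl invr_gt0.
have aek k : {ae mu, forall x, `]a k, b k[%classic x -> w x = 0}.
  pose wk := w \_ `[a k, b k].
  have jab : rintegrable `[a k, b k] w.
    apply/integrableP; split; last by apply: lfw => //; exact: segment_compact.
    by apply/measurable_EFinP; apply: measurable_funS mw => //.
  have jwk : rintegrable setT wk.
    by rewrite -restrict_EFin; apply/integrable_restrict => //; rewrite setTI.
  have lwk : locally_integrable setT wk by apply: open_integrable_locally; [exact: openT|exact: jwk].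
  have jy (y : R) : rintegrable [set` Interval (BLeft (a k)) (BRight y)] wk.
    by apply: integrableS jwk => //.
  have := FTC1 jy lwk.
  apply: filterS; first exact: (ae_filter_ringOfSetsType mu).
  move=> x + xab; have /= := xab; rewrite in_itv/= => /andP[ax xb].
  rewrite /= lte_fin => /(_ ax)[_].
  rewrite {2}/wk patchE mem_set; last exact: subset_itv_oo_cc.
  move=> <-; rewrite derive1E.
  rewrite (@near_eq_derive _ _ _ _ (fun=> 0)) ?derive_cst//.
  near=> y.
  have ay : a k < y by near: y; exact: lt_nbhsr.
  have yb : y < b k by near: y; exact: lt_nbhsl.
  have yU : `[a k, y] `<=` `]A, B[.
    apply: subset_trans (abU k); apply: subset_itvl; rewrite bnd_simp; exact: ltW.
  rewrite -(test_ortho_itv lw ortho yU).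
  rewrite -Rintegral_itv_bndo_bndc; last first.
    apply: integrableS (jy y) => //; apply: subset_itvl; by rewrite bnd_simp.
  rewrite -Rintegral_itv_obnd_cbnd; last first.
    apply: integrableS (jy y) => //; exact: subset_itv_oo_cc.
  apply: eq_Rintegral => z; rewrite inE/= in_itv/= => /andP[az zy].
  by rewrite /wk patchE mem_set//= in_itv/= ltW// (ltW (lt_trans zy yb)).
have := ae_foralln aek; apply: filterS => x h /=; rewrite in_itv/= => /andP[Ax xB].
have xA0 : 0 < x - A by rewrite subr_gt0.
have xB0 : 0 < B - x by rewrite subr_gt0.
near \oo => k; apply: (h k); rewrite /= in_itv/= /a /b; apply/andP; split.
- by rewrite -ltrBrDl; near: k; exact: (near_infty_natSinv_lt (PosNum xA0)).
- rewrite ltrBrDr -ltrBrDl; near: k; exact: (near_infty_natSinv_lt (PosNum xB0)).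
Unshelve. all: by end_near.
Qed.

End Variations.

(** * Derivatives of monotone Schwartz weights *)

Section Weight.
Context {R : realType}.
Implicit Types (u : R -> R) (j n N : nat) (A B x y : R).

Lemma derive1n_shift_sub j u (d : R) : smooth u ->
  derive1n j (fun y => u (y + d) - u y) =
  (fun y => derive1n j u (y + d) - derive1n j u y).
Proof.
move=> su; elim: j => [//|j IH]; rewrite !derive1nS IH.
apply: is_derive1_derive1 => x.
apply: (@is_derive1D _ (fun y => derive1n j u (y + d)) (fun y => - derive1n j u y)).
  have su' := smooth_is_derive (x + d) (smooth_derive1n j su).
  have ds : is_derive x 1 (fun y : R => y + d) (1 + 0).
    exact: (is_derive1D (is_derive_id x 1) (is_derive_cst d x 1)).
  have := @is_derive1_chain _ _ (fun y : R => y + d) x _ _ su' ds.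
  by rewrite addr0 mulr1.
exact: (is_derive1N (smooth_is_derive x (smooth_derive1n j su))).
Qed.

Lemma smooth_mvt u x y : smooth u -> x <= y ->
  exists2 z, x <= z <= y & u y - u x = derive1 u z * (y - x).
Proof.
move=> su xy; have [||z] := @MVT_segment R u (derive1 u) x y xy.
- by move=> z _; exact: smooth_is_derive.
- by apply: continuous_subspaceT; exact: smooth_continuous.
- by rewrite in_itv/= => ? ?; exists z.
Qed.

(** Induction on j through the difference v y = u (y + d) - u y, which is
    bounded by 2 A. By the mean value theorem a point where the j-th
    derivative of v is small yields, at distance at most d, a point where d
    times the derivative of u of order j + 1 is. *)
Lemma small_derive1n_point j u x A (d : R) : smooth u -> 0 < d ->
  (forall y, x <= y -> `|u y| <= A) ->
  exists2 z, x <= z <= x + j%:R * d & `|derive1n j u z| <= 2 ^+ j * A / d ^+ j.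
Proof.
move=> su d0 uA; elim: j u A su uA => [|j IH] u A su uA.
  exists x; first by rewrite mul0r addr0 lexx.
  by rewrite !expr0 mul1r divr1 uA.
have sv : smooth (fun y => u (y + d) - u y).
  apply: smoothB; last exact: su.
  apply: (@smooth_comp _ u (fun y => y + d)); first exact: su.
  by apply: smoothD; [exact: smooth_id|exact: smooth_cst].
have [|z /andP[xz zx]] := IH _ (2 * A) sv.
  move=> y xy; rewrite (le_trans (ler_normB _ _))// mulr_natl mulr2n lerD ?uA//.
  by rewrite (le_trans xy)// lerDl ltW.
rewrite derive1n_shift_sub//.
have zd : z <= z + d by rewrite lerDl ltW.
have [w /andP[zw wz] ->] := smooth_mvt (smooth_derive1n j su) zd.
rewrite addrAC subrr add0r normrM (gtr0_norm d0) -derive1nS => h.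
exists w.
  rewrite (le_trans xz zw)/= (le_trans wz)//.
  by rewrite -[j.+1]addn1 natrD mulrDl mul1r addrA lerD2r.
rewrite -(ler_pM2r d0) (le_trans h)// [d ^+ j.+1]exprSr invfM.
by rewrite !mulrA divfK ?gt_eqF// exprSr -!mulrA [A * _]mulrC.
Qed.

(** Descending induction on the order n - k of the derivative. The derivative
    of order n - k - 1 is small at some point within distance (n - k - 1) d of
    y by [small_derive1n_point]; going from there to y costs that distance
    times the bound already known for the order n - k. *)
Lemma landau_interpolation n k : (k <= n)%N -> exists2 C : R, 0 <= C &
  forall u x A B (d : R), smooth u -> 0 < d ->
  (forall y, x <= y -> `|u y| <= A) ->
  (forall y, x <= y -> `|derive1n n u y| <= B) ->
  forall y, x <= y ->
    `|derive1n (n - k) u y| <= C * (A / d ^+ (n - k) + B * d ^+ k).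
Proof.
elim: k => [_|k IH kn].
  exists 1 => // u x A B d su d0 uA uB y xy.
  rewrite subn0 mul1r expr0 mulr1 (le_trans (uB _ xy))// lerDr.
  by rewrite divr_ge0 ?exprn_ge0 ?(ltW d0)// (le_trans _ (uA _ xy)).
have [C C0 HC] := IH (ltnW kn).
set j := (n - k.+1)%N; have jE : (n - k)%N = j.+1 by rewrite /j -subSn// subSS.
exists (2 ^+ j + j%:R * C); first by rewrite addr_ge0// ?mulr_ge0// exprn_ge0.
move=> u x A B d su d0 uA uB y xy.
have A0 : 0 <= A by rewrite (le_trans _ (uA _ xy)).
have B0 : 0 <= B by rewrite (le_trans _ (uB _ xy)).
have uAy z : y <= z -> `|u z| <= A by move=> yz; rewrite uA// (le_trans xy).
have [z /andP[yz zy] hz] := small_derive1n_point j su d0 uAy.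
have [w /andP[yw wz] E] := smooth_mvt (smooth_derive1n j su) yz.
have -> : derive1n j u y = derive1n j u z - derive1n j.+1 u w * (z - y).
  by rewrite derive1nS -E; ring.
have xw := le_trans xy yw.
have hw := HC u x A B d su d0 uA uB w xw; rewrite jE in hw.
have zyd : `|z - y| <= j%:R * d.
  by rewrite ger0_norm ?subr_ge0// lerBlDr addrC.
rewrite (le_trans (ler_normB _ _))// mulrDl lerD//.
  rewrite (le_trans hz)// -mulrA ler_wpM2l ?exprn_ge0// lerDl.
  by rewrite mulr_ge0// exprn_ge0// ltW.
rewrite normrM (le_trans (ler_pM (normr_ge0 _) (normr_ge0 _) hw zyd))//.
rewrite le_eqVlt; apply/orP; left; apply/eqP.
rewrite !exprS; field.
by rewrite expf_neq0 ?gt_eqF.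
Qed.

Lemma exists_root j (s : R) : 0 < s -> exists2 d : R, 0 < d & d ^+ j.+1 = s.
Proof.
move=> s0; exists (s `^ j.+1%:R^-1); first exact: powR_gt0.
by rewrite -powR_mulrn ?powR_ge0// -powRrM mulVf// powRr1// ltW.
Qed.

Lemma landau_sqr j : exists2 C : R, 0 <= C & forall u x A B, smooth u ->
  0 < A -> 0 < B ->
  (forall y, x <= y -> `|u y| <= A) ->
  (forall y, x <= y -> `|derive1n (j + j) u y| <= B) ->
  (derive1n j u x) ^+ 2 <= C * (A * B).
Proof.
case: j => [|j].
  exists 1 => // u x A B su A0 B0 uA uB.
  by rewrite mul1r -real_normK ?num_real// expr2 ler_pM ?uA ?uB.
have [C C0 HC] := @landau_interpolation (j.+1 + j.+1) j.+1 (leq_addl _ _).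
exists (C ^+ 2 * 4); first by rewrite mulr_ge0 ?sqr_ge0.
move=> u x A B su A0 B0 uA uB.
(* With d^j.+1 = sqrt (A / B) both terms of the interpolation inequality are
   equal to sqrt (A B). *)
pose s := Num.sqrt A / Num.sqrt B.
have sA : 0 < Num.sqrt A by rewrite sqrtr_gt0.
have sB : 0 < Num.sqrt B by rewrite sqrtr_gt0.
have [d d0 ds] := @exists_root j s (divr_gt0 sA sB).
have := HC u x A B d su d0 uA uB x (lexx x).
rewrite addnK ds /s => h.
have h2 : A / (Num.sqrt A / Num.sqrt B) + B * (Num.sqrt A / Num.sqrt B) =
    2 * (Num.sqrt A * Num.sqrt B).
  rewrite -{1}(sqr_sqrtr (ltW A0)) -{2}(sqr_sqrtr (ltW B0)); field.
  by rewrite !gt_eqF.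
rewrite h2 in h.
rewrite -real_normK ?num_real// (@le_trans _ _ ((C * (2 * (Num.sqrt A * Num.sqrt B))) ^+ 2))//.
  by rewrite lerXn2r// nnegrE mulr_ge0// mulr_ge0// mulr_ge0// ltW.
rewrite !exprMn (sqr_sqrtr (ltW A0)) (sqr_sqrtr (ltW B0)) le_eqVlt; apply/orP; left; apply/eqP; ring.
Qed.

(** Beyond K monotonicity bounds u on the half-line from x by u x, and the
    decay of its derivative of order 2 j bounds the latter there by a constant
    over (1+x^2)^N; [landau_sqr] combines both. *)
Lemma half_line_weight u (K M : R) j N : smooth u -> 0 < K -> 0 < M ->
  (forall x, 0 < u x) -> (forall z, K < z -> derive1 u z <= 0) ->
  (forall y, `|derive1n (j + j) u y| * (1 + y ^+ 2) ^+ N <= M) ->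
  exists2 C : R, 0 <= C &
  forall x, K < x -> (derive1n j u x) ^+ 2 * (1 + x ^+ 2) ^+ N <= C * u x.
Proof.
move=> su K0 M0 u0 u'0 uM; have [C C0 HC] := landau_sqr j.
exists (C * M); first by rewrite mulr_ge0// ltW.
move=> x Kx; have x0 := lt_trans K0 Kx.
have w0 (y : R) : 0 < (1 + y ^+ 2) ^+ N.
  by rewrite exprn_gt0// ltr_pwDl// sqr_ge0.
rewrite -ler_pdivlMr//.
have -> : C * M * u x / (1 + x ^+ 2) ^+ N = C * (u x * (M / (1 + x ^+ 2) ^+ N)) by ring.
apply: HC => //; first by rewrite divr_gt0.
- move=> y xy; rewrite gtr0_norm//.
  have [z /andP[xz zy]] := smooth_mvt su xy.
  move/eqP; rewrite subr_eq => /eqP ->; rewrite gerDr.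
  by rewrite mulr_le0_ge0 ?subr_ge0// u'0// (lt_le_trans Kx).
- move=> y xy; rewrite ler_pdivlMr// (le_trans _ (uM y))// ler_wpM2l//.
  rewrite lerXn2r ?nnegrE ?addr_ge0 ?sqr_ge0//.
  by rewrite lerD2l lerXn2r ?nnegrE ?(ltW x0)// (le_trans (ltW x0)).
Qed.

Lemma derive1n_opp j u : smooth u ->
  derive1n j (fun x => u (- x)) = fun x => (-1) ^+ j * derive1n j u (- x).
Proof.
move=> su; elim: j => [|j IH].
  by apply/funext => x; rewrite mul1r.
rewrite !derive1nS IH; apply: is_derive1_derive1 => x.
have su' := smooth_is_derive (- x) (smooth_derive1n j su).
have dN := is_derive1N (is_derive_id x 1).
have dC := @is_derive1_chain _ _ (fun y : R => - y) x _ _ su' dN.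
have := is_derive1M (is_derive_cst ((-1) ^+ j : R) x 1) dC.
by congr is_derive; rewrite mulr0 addr0 exprS /cst; ring.
Qed.

Lemma schwartz_decay u N b : schwartz u ->
  exists2 M : R, 0 < M & forall x, `|derive1n b u x| * (1 + x ^+ 2) ^+ N <= M.
Proof.
move=> [_ hu].
suff : forall a, exists M : R, forall x, `|x ^+ a * derive1n b u x| * (1 + x ^+ 2) ^+ N <= M.
  move=> /(_ 0%N)[M HM]; exists (`|M| + 1); first by rewrite ltr_wpDl.
  move=> x; have := HM x; rewrite expr0 mul1r => /le_trans; apply.
  by rewrite (le_trans (ler_norm _))// lerDl.
elim: N => [|N IH] a.
  by have [M HM] := hu a b; exists M => x; rewrite expr0 mulr1.
have [M1 H1] := IH a; have [M2 H2] := IH a.+2.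
exists (M1 + M2) => x; rewrite exprS mulrCA mulrDl mul1r lerD//.
rewrite (le_trans _ (H2 x))// mulrA ler_wpM2r ?exprn_ge0 ?addr_ge0 ?sqr_ge0//.
by rewrite -[x ^+ 2]ger0_norm ?sqr_ge0// -normrM mulrA -exprD.
Qed.

(** Beyond K this is [half_line_weight], applied to rho on the right and to
    its reflection on the left; on the remaining compact interval rho has a
    positive minimum. *)
Lemma schwartz_mon_weight (rho : R -> R) j N : schwartz_mon rho ->
  exists2 C : R, 0 <= C &
  forall x, (derive1n j rho x) ^+ 2 * (1 + x ^+ 2) ^+ N <= C * rho x.
Proof.
move=> [sch rho0 [K K0 monK]]; have [srho _] := sch.
have [M M0 HM] := schwartz_decay N (j + j) sch.
have w0 (y : R) : 0 < (1 + y ^+ 2) ^+ N.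
  by rewrite exprn_gt0// ltr_pwDl// sqr_ge0.
have outK (x : R) : K < `|x| -> x \notin (`[- K, K] : set R).
  by rewrite notin_setE /= in_itv/= -ler_norml => h; apply/negP; rewrite -ltNge.
have [C1 C10 H1] : exists2 C : R, 0 <= C & forall x, K < x ->
    (derive1n j rho x) ^+ 2 * (1 + x ^+ 2) ^+ N <= C * rho x.
  apply: (half_line_weight srho K0 M0 rho0 _ HM) => z Kz.
  have z0 := lt_trans K0 Kz.
  by have := monK z; rewrite outK ?gtr0_norm// pmulr_rle0//; apply.
have [C2 C20 H2] : exists2 C : R, 0 <= C & forall x, K < x ->
    (derive1n j (fun y => rho (- y)) x) ^+ 2 * (1 + x ^+ 2) ^+ N <= C * rho (- x).
{ apply: (@half_line_weight (fun y => rho (- y)) K M j N) => //.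
  - apply: (@smooth_comp _ rho (fun y => - y)); first exact: srho.
    by apply: smoothN; exact: smooth_id.
  - move=> z Kz; have z0 := lt_trans K0 Kz.
    have := @derive1n_opp 1 rho srho; rewrite !derive1n1 => ->.
    rewrite expr1 mulN1r oppr_le0.
    have := monK (- z); rewrite outK ?normrN ?gtr0_norm// mulNr oppr_le0.
    by rewrite pmulr_rge0//; apply.
  - move=> y; rewrite derive1n_opp// normrM normrX normrN1 expr1n mul1r.
    by have := HM (- y); rewrite sqrrN. }
have [M1 M10 HM1] := schwartz_decay N j sch.
have [M2 M20 HM2] := schwartz_decay 0 j sch.
have NKK : - K <= K by rewrite ge0_cp// ltW.
have [z zK hz] := @EVT_min R rho (- K) K NKK
  (continuous_subspaceT (smooth_continuous srho)).
have C30 : 0 <= M1 * M2 / rho z by rewrite divr_ge0 ?mulr_ge0// ltW.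
exists (C1 + C2 + M1 * M2 / rho z); first by rewrite !addr_ge0.
move=> x; have rx := ltW (rho0 x).
rewrite !mulrDl; have [xK|Kx] := leP `|x| K.
  rewrite (@le_trans _ _ (M1 * M2 / rho z * rho x))//; last first.
    by rewrite lerDr addr_ge0// mulr_ge0.
  rewrite (@le_trans _ _ (M1 * M2))//.
    rewrite -real_normK ?num_real// expr2 mulrAC ler_pM ?mulr_ge0 ?(ltW (w0 _))//.
    by have := HM2 x; rewrite expr0 mulr1.
  have zx : 1 <= rho x / rho z.
    by rewrite ler_pdivlMr// mul1r hz// in_itv/= -ler_norml.
  rewrite mulrAC -mulrA -[X in X <= _]mulr1 ler_wpM2l//.
  by rewrite mulr_ge0 ?(ltW M10) ?(ltW M20).
rewrite (@le_trans _ _ (C1 * rho x + C2 * rho x))//; last by rewrite lerDl mulr_ge0.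
have [x0|x0] := leP 0 x.
  by rewrite ger0_norm// in Kx; rewrite (le_trans (H1 _ Kx))// lerDl mulr_ge0.
rewrite ltr0_norm// in Kx; have := H2 _ Kx.
rewrite derive1n_opp// !opprK exprMn -exprM mulnC exprM sqrrN expr1n expr1n mul1r sqrrN.
by move=> /le_trans; apply; rewrite lerDr mulr_ge0.
Qed.

End Weight.

(** * Real integrals over the circle *)

Section CircleReal.
Context {R : realType}.
Notation mu := (@lebesgue_measure R).
Variables (c : R) (hc : 0 < c).

Let funepos_scale (u : R -> R) (v : R -> R) (k : R -> R) x : 0 < k x ->
  ((fun x => (u (v x) * k x)%R%:E)^\+ x = (EFin \o u)^\+ (v x) * (k x)%:E)%E.
Proof.
move=> k0; rewrite !funeposE /= -EFin_max -EFin_max -EFinM.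
by rewrite maxr_pMl ?(ltW k0)// mul0r.
Qed.

Let funeneg_scale (u : R -> R) (v : R -> R) (k : R -> R) x : 0 < k x ->
  ((fun x => (u (v x) * k x)%R%:E)^\- x = (EFin \o u)^\- (v x) * (k x)%:E)%E.
Proof.
move=> k0; rewrite !funenegE /= -EFin_max -EFin_max -EFinM.
by rewrite maxr_pMl ?(ltW k0)// mul0r mulNr.
Qed.

Lemma Rintegral_circle (u : R -> R) : measurable_fun circle_dom u ->
  \int[mu]_(t in circle_dom) u t =
  \int[mu]_x (u (mobius_inv c x) * mobius_inv' c x).
Proof.
move=> mu_; have mu' : measurable_fun (circle_dom : set R) (EFin \o u) by exact/measurable_EFinP.
rewrite /Rintegral; congr fine; rewrite [LHS]integralE [RHS]integralE.
congr (_ - _)%E.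
  rewrite (ge0_integral_circle hc)//; last exact: measurable_funepos.
  by apply: eq_integral => x _; rewrite funepos_scale// mobius_inv'_gt0.
rewrite (ge0_integral_circle hc)//; last exact: measurable_funeneg.
by apply: eq_integral => x _; rewrite funeneg_scale// mobius_inv'_gt0.
Qed.

Lemma measurable_circle_comp (u : R -> R) : measurable_fun circle_dom u ->
  measurable_fun setT (fun x => u (mobius_inv c x)).
Proof.
move=> mu_; apply: (measurable_comp (F := circle_dom)) => //.
- exact: measurable_circle_dom.
- by move=> _ [x _ <-]; exact: mobius_inv_circle.
- exact: measurable_mobius_inv.
Qed.

Lemma rintegrable_circle (u : R -> R) : measurable_fun circle_dom u ->
  rintegrable circle_dom u <->
  rintegrable setT (fun x => u (mobius_inv c x) * mobius_inv' c x).
Proof.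
move=> mu_.
have mk : measurable_fun setT (fun x => u (mobius_inv c x) * mobius_inv' c x).
  by apply: measurable_funM; [exact: measurable_circle_comp|exact: measurable_mobius_inv'].
have E : (\int[mu]_(t in circle_dom) `|(EFin \o u) t| =
    \int[mu]_x `|(EFin \o (fun x => u (mobius_inv c x) * mobius_inv' c x)%R) x|)%E.
  rewrite (ge0_integral_circle hc)//.
    apply: eq_integral => x _ /=.
    by rewrite normrM EFinM (gtr0_norm (mobius_inv'_gt0 hc x)).
  by apply/measurable_EFinP; apply: measurableT_comp.
split=> /integrableP[_ lt]; apply/integrableP; split.
- exact/measurable_EFinP.
- by rewrite -E.
- exact/measurable_EFinP.
- by rewrite E.
Qed.

Lemma lebesgue_circle_lty : (mu (circle_dom : set R) < +oo)%E.
Proof. by rewrite lebesgue_measure_itv; case: ifP => _; rewrite ?ltry// -EFinB ltry. Qed.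

Lemma circle_rintegrable_cst (k : R) : rintegrable circle_dom (fun=> k : R).
Proof.
apply/integrableP; split; first exact: measurable_cst.
rewrite integral_cst; last exact: measurable_circle_dom.
by rewrite lte_mul_pinfty// lebesgue_circle_lty.
Qed.

Lemma rintegrable_mobius_inv' : rintegrable setT (mobius_inv' c).
Proof.
have /(rintegrable_circle (@measurable_cst _ _ _ _ _ (1:R)) ) := circle_rintegrable_cst 1.
by apply: eq_rintegrable => // x _; rewrite mul1r.
Qed.

End CircleReal.

(** * Multipliers dominated by the weight *)

Section Admissible.
Context {R : realType}.
Notation mu := (@lebesgue_measure R).
Variable rho : R -> R.

(** The functions that arise when p d/dx is applied repeatedly to p rho f and
    the derivatives of f are factored out. *)
Inductive admissible : (R -> R) -> Prop :=
| AdmBase (q : {poly R}) j : admissible (fun x => q.[x] * derive1n j rho x)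
| AdmAdd f g : admissible f -> admissible g -> admissible (fun x => f x + g x).

Lemma adm_mulp (q : {poly R}) f : admissible f -> admissible (fun x => q.[x] * f x).
Proof.
elim=> {f} [r j|f g _ Hf _ Hg].
  rewrite (_ : (fun _ => _) = fun x => (q * r).[x] * derive1n j rho x).
    exact: AdmBase.
  by apply/funext => x; rewrite hornerM mulrA.
rewrite (_ : (fun _ => _) = fun x => q.[x] * f x + q.[x] * g x).
  exact: AdmAdd.
by apply/funext => x; rewrite mulrDr.
Qed.

Lemma adm0 : admissible (fun=> 0).
Proof.
rewrite (_ : (fun _ => _) = fun x => (0 : {poly R}).[x] * derive1n 0 rho x).
  exact: AdmBase.
by apply/funext => x; rewrite horner0 mul0r.
Qed.

Lemma adm_weightfun : admissible rho.
Proof.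
rewrite (_ : rho = fun x => (1 : {poly R}).[x] * derive1n 0 rho x).
  exact: AdmBase.
by apply/funext => x; rewrite hornerC mul1r.
Qed.

Hypothesis hrho : schwartz_mon rho.
Let srho : smooth rho. Proof. by case: hrho => -[]. Qed.
Let rho_gt0 x : 0 < rho x. Proof. by case: hrho. Qed.

Lemma adm_is_derive f : admissible f -> exists2 g, admissible g & forall x : R, is_derive x 1 f (g x).
Proof.
elim=> {f} [q j|f g _ [df Af fE] _ [dg Ag gE]].
  exists (fun x => q.[x] * derive1n j.+1 rho x + q^`().[x] * derive1n j rho x).
    by apply: AdmAdd; exact: AdmBase.
  move=> x; have := is_derive1M (is_derive_poly q x)
    (smooth_is_derive x (smooth_derive1n j srho)).
  by congr is_derive; rewrite derive1nS [X in _ = _ + X]mulrC.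
exists (fun x => df x + dg x); first exact: AdmAdd.
by move=> x; exact: is_derive1D.
Qed.

Lemma adm_smooth f : admissible f -> smooth f.
Proof. apply: smooth_coind; exact: adm_is_derive. Qed.

Lemma adm_derive1 f : admissible f -> admissible f^`().
Proof. by move=> /adm_is_derive[g Ag fg]; rewrite (is_derive1_derive1 fg). Qed.

Lemma poly_growth (q : {poly R}) : exists2 C : R, 0 <= C & exists k,
  forall x, q.[x] ^+ 2 <= C * (1 + x ^+ 2) ^+ k.
Proof.
elim/poly_ind: q => [|q a [C C0 [k HC]]].
  by exists 0 => //; exists 0%N => x; rewrite horner0 expr0n mul0r.
exists (2 * C + 2 * a ^+ 2).
  by apply: addr_ge0; apply: mulr_ge0 => //; exact: sqr_ge0.
exists k.+1 => x; rewrite hornerMXaddC.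
have w1 : 1 <= 1 + x ^+ 2 by rewrite lerDl sqr_ge0.
have w0 := le_trans ler01 w1.
rewrite (@le_trans _ _ (2 * (q.[x] * x) ^+ 2 + 2 * a ^+ 2))//.
  rewrite -subr_ge0 (_ : _ - _ = (q.[x] * x - a) ^+ 2) ?sqr_ge0//; ring.
rewrite [X in _ <= X]mulrDl lerD//.
  rewrite -[X in _ <= X]mulrA ler_pM2l// exprMn [_ ^+ k.+1]exprSr [X in _ <= X]mulrA.
  by rewrite ler_pM ?sqr_ge0 ?HC// lerDr.
rewrite -[X in X <= _]mulr1; apply: ler_wpM2l; last exact: exprn_ege1.
by apply: mulr_ge0 => //; exact: sqr_ge0.
Qed.

(** The power N is arbitrary in [schwartz_mon_weight], so it absorbs the
    polynomial factors. *)
Lemma adm_weight f N : admissible f -> exists2 C : R, 0 <= C &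
  forall x, f x ^+ 2 * (1 + x ^+ 2) ^+ N <= C * rho x.
Proof.
elim=> {f} [q j|f g _ [Cf Cf0 fE] _ [Cg Cg0 gE]].
  have [Cq Cq0 [k HC]] := poly_growth q.
  have [C C0 H] := schwartz_mon_weight j (k + N) hrho.
  exists (Cq * C); first exact: mulr_ge0.
  move=> x; have w0 : 0 <= 1 + x ^+ 2 by rewrite addr_ge0// sqr_ge0.
  rewrite exprMn (@le_trans _ _ (Cq * (1 + x ^+ 2) ^+ k * derive1n j rho x ^+ 2 * (1 + x ^+ 2) ^+ N))//.
    rewrite ler_wpM2r ?exprn_ge0// ler_wpM2r ?sqr_ge0//.
  have := ler_wpM2l Cq0 (H x); rewrite exprD [X in _ <= X]mulrA; apply: le_trans.
  by move: (_ ^+ k) (_ ^+ N) (derive1n _ _ _) => a b e; rewrite le_eqVlt (_ : _ == _)//; apply/eqP; ring.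
exists (2 * Cf + 2 * Cg); first by rewrite addr_ge0// mulr_ge0.
move=> x; have w0 : 0 <= (1 + x ^+ 2) ^+ N by rewrite exprn_ge0// addr_ge0// sqr_ge0.
rewrite (@le_trans _ _ (2 * (f x ^+ 2 * (1 + x ^+ 2) ^+ N) + 2 * (g x ^+ 2 * (1 + x ^+ 2) ^+ N)))//.
  rewrite -subr_ge0 (_ : _ - _ = (f x - g x) ^+ 2 * (1 + x ^+ 2) ^+ N).
    by rewrite mulr_ge0 ?sqr_ge0.
  ring.
by rewrite [X in _ <= X]mulrDl -![X in _ <= X + _]mulrA -[X in _ <= _ + X]mulrA lerD// ler_pM2l.
Qed.

Definition weighted_L2 (h : R -> R) :=
  measurable_fun setT h /\ rintegrable setT (fun x => h x ^+ 2 * rho x).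

Lemma measurable_adm f : admissible f -> measurable_fun setT f.
Proof.
move=> Af; apply: continuous_measurable_fun; apply: smooth_continuous.
exact: adm_smooth.
Qed.

(** Put s = h m. Then |s| <= s^2 (1 + x^2) + 2 / (1 + x^2); the first term is
    at most C h^2 rho by [adm_weight], and the second is the integrable
    function [mobius_inv' 1]. *)
Lemma weighted_L2_rintegrable h m : weighted_L2 h -> admissible m ->
  rintegrable setT (fun x => h x * m x).
Proof.
move=> [mh hL2] Am; have [C C0 HC] := adm_weight 1 Am.
have mm := measurable_adm Am.
apply: (@le_rintegrable _ _ _ (fun x => C * (h x ^+ 2 * rho x) + mobius_inv' 1 x)) => //.
- exact: measurable_funM.
- move=> x _; have w0 : 0 < 1 + x ^+ 2 by rewrite ltr_pwDl// sqr_ge0.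
  rewrite (@le_trans _ _ (((h x * m x) ^+ 2 * (1 + x ^+ 2)) + 2 / (1 + x ^+ 2)))//.
    set s := h x * m x; have -> : `|s| = Num.sqrt (s ^+ 2) by rewrite sqrtr_sqr.
    rewrite sqrtr_sqr -[s ^+ 2]real_normK ?num_real//; move: `|s| => t.
    rewrite -subr_ge0 -(pmulr_lge0 _ w0) mulrBl mulrDl divfK ?gt_eqF//.
    move: (1 + x ^+ 2) => w; have := sqr_ge0 (t * w - 1); have := sqr_ge0 (t * w).
    by rewrite !expr2; lra.
  rewrite lerD// ?/mobius_inv' ?expr1n ?mulr1//.
  have := ler_wpM2l (sqr_ge0 (h x)) (HC x); rewrite expr1 [X in _ <= X]mulrCA.
  by apply: le_trans; rewrite exprMn -[X in X <= _]mulrA.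
- apply: rintegrableD => //; first exact: rintegrableZ.
  exact: rintegrable_mobius_inv'.
Qed.

(** The value at 0 may be any nonzero number: it factors out of the limit in
    [weak_ibp]. *)
Lemma exists_cutoff : exists chi : R -> R,
  [/\ smooth chi, forall x, x \notin `](-1), 1[%R -> chi x = 0,
      forall x, `|chi x| <= 1 & chi 0 != 0].
Proof.
exists (bump (-1) 1 0); split.
- exact: bump_smooth.
- by move=> x; exact: bump_out.
- by move=> x; exact: bump_bound.
- rewrite /bump /flat !hornerC !mul1r sub0r opprK subr0 ltr01.
  by rewrite mulf_neq0// gt_eqF ?expR_gt0.
Qed.

(** The hypothesis on h and h1 only involves test functions, and m Psi is not
    one. It is multiplied by the dilated cutoffs chi (x / (n + 1)), whose
    derivatives are of order 1 / n; since h m, h m' and h1 m are integrable,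
    dominated convergence removes the cutoff. *)
Lemma weak_ibp h h1 m Psi (B0 B1 : R) :
  weighted_L2 h -> weighted_L2 h1 ->
  (forall psi, test_fun setT psi ->
    \int[mu]_x (h x * (derive1 psi) x) = - \int[mu]_x (h1 x * psi x)) ->
  admissible m -> smooth Psi -> (forall x, `|Psi x| <= B0) -> (forall x, `|(derive1 Psi) x| <= B1) ->
  \int[mu]_x (h x * m x * (derive1 Psi) x) =
  - \int[mu]_x ((h x * (derive1 m) x + h1 x * m x) * Psi x).
Proof.
move=> hL2 h1L2 weak Am sPsi PB0 PB1.
have sm := adm_smooth Am; have Am' := adm_derive1 Am.
have jhm := weighted_L2_rintegrable hL2 Am.
have jhm' := weighted_L2_rintegrable hL2 Am'.
have jh1m := weighted_L2_rintegrable h1L2 Am.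
have B00 : 0 <= B0 by rewrite (le_trans _ (PB0 0)).
have B10 : 0 <= B1 by rewrite (le_trans _ (PB1 0)).
have cmeas (f : R -> R) : smooth f -> measurable_fun setT f.
  by move=> sf; apply: continuous_measurable_fun; exact: (smooth_continuous sf).
have [chi [schi chi_out chi1 chi0_neq0]] := exists_cutoff.
have chi_test : test_fun setT chi.
  split; [exact: schi|exists `[-1, 1]; split => //; first exact: segment_compact].
  move=> x /= /negP x1; apply: chi_out; apply: contra x1; exact: subset_itv_oo_cc.
have [D D0 chiD] := test_fun_bounded (test_fun_derive1 chi_test).
pose r n : R := n.+1%:R^-1.
have r01 n : 0 <= r n <= 1 by rewrite invr_ge0 ler0n/= invf_le1 ?ler1n ?ltr0n.
pose X n x : R := chi (r n * x).
pose X' n x : R := r n * (derive1 chi) (r n * x).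
have sX n : smooth (X n).
  apply: (@smooth_comp _ chi (fun x => r n * x)); first exact: schi.
  by apply: smoothM; [exact: smooth_cst|exact: smooth_id].
have dX n (x : R) : is_derive x 1 (X n) (X' n x).
  have dl : is_derive x 1 (fun x : R => r n * x) (r n).
    have := is_derive1M (is_derive_cst (r n) x 1) (is_derive_id x 1).
    by rewrite mulr0 addr0 mulr1.
  have := @is_derive1_chain _ chi (fun x : R => r n * x) x _ _ (smooth_is_derive (r n * x) schi) dl.
  by rewrite mulrC.
have sX' n : smooth (X' n).
  rewrite -(is_derive1_derive1 (dX n)); exact: (smoothS (sX n)).
pose F n x := h x * m x * (X' n x * Psi x + X n x * (derive1 Psi) x) +
  (h x * (derive1 m) x + h1 x * m x) * (X n x * Psi x).
have bX n x : `|X n x| <= 1 by exact: chi1.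
have bX' n x : `|X' n x| <= r n * D.
  have /andP[rn0 _] := r01 n.
  by rewrite /X' normrM (ger0_norm rn0) ler_wpM2l.
have b1M n x : `|X' n x * Psi x + X n x * derive1 Psi x| <= D * B0 + B1.
  have /andP[_ r1] := r01 n.
  rewrite (le_trans (ler_normD _ _))// (normrM (X' n x)) (normrM (X n x)) lerD//.
    by apply: ler_pM => //; rewrite (le_trans (bX' n x))// ler_piMl.
  by rewrite -[B1]mul1r ler_pM.
have b2M n x : `|X n x * Psi x| <= B0.
  by rewrite (normrM (X n x)) -[B0]mul1r ler_pM.
have mb2 n : measurable_fun setT (fun x => X n x * Psi x).
  exact: (measurable_funM (cmeas _ (sX n)) (cmeas _ sPsi)).
have mb1 n : measurable_fun setT (fun x => X' n x * Psi x + X n x * derive1 Psi x).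
  apply: measurable_funD.
    exact: (measurable_funM (cmeas _ (sX' n)) (cmeas _ sPsi)).
  exact: (measurable_funM (cmeas _ (sX n)) (cmeas _ (smoothS sPsi))).
have mPsi' := cmeas _ (smoothS sPsi).
have jF1 n := rintegrableM measurableT jhm (mb1 n) (fun x _ => b1M n x).
have jF2 n := rintegrableM measurableT jhm' (mb2 n) (fun x _ => b2M n x).
have jF3 n := rintegrableM measurableT jh1m (mb2 n) (fun x _ => b2M n x).
have jF n : rintegrable setT (F n).
  have := rintegrableD measurableT (jF1 n) (rintegrableD measurableT (jF2 n) (jF3 n)).
  by apply: eq_rintegrable => // x _; rewrite /F; ring.
have F0 n : \int[mu]_x F n x = 0.
(* F n is the integrand obtained by testing with the cut-off product m Psi. *)
{ pose psi x := X n x * (m x * Psi x).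
  have spsi : smooth psi by apply: smoothM; [exact: sX|apply: smoothM; [exact: sm|exact: sPsi]].
  have tpsi : test_fun setT psi.
    split; first exact: spsi.
    exists `[- n.+1%:R, n.+1%:R]; split => //; first exact: segment_compact.
    move=> x /= /negP xn; rewrite /psi /X chi_out ?mul0r//.
    move: xn; apply: contra; rewrite !in_itv/= => /andP[x1 x2].
    have n0 : 0 < n.+1%:R :> R by rewrite ltr0n.
    move: x1 x2; rewrite /r mulrC ltr_pdivlMr// ltr_pdivrMr// mulN1r mul1r => x1 x2.
    by rewrite !ltW.
  have dpsi x : derive1 psi x = X n x * (m x * derive1 Psi x + Psi x * derive1 m x) + (m x * Psi x) * X' n x.
    rewrite derive1E; apply: derive_val.
    have dm := is_derive1M (smooth_is_derive x sm) (smooth_is_derive x sPsi).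
    exact: (is_derive1M (dX n x) dm).
  have /eqP := weak _ tpsi; rewrite -subr_eq0 opprK => /eqP.
  rewrite -RintegralD//.
  - by move=> <-; apply: eq_Rintegral => x _; rewrite dpsi /F /psi; ring.
  - have := rintegrableD measurableT (jF1 n) (jF2 n).
    by apply: eq_rintegrable => // x _; rewrite dpsi; ring.
  - by have := jF3 n; apply: eq_rintegrable => // x _; rewrite /psi; ring. }
have rcvg x : r n * x @[n --> \oo] --> (0 : R).
  by rewrite -[X in _ --> X](mul0r x); apply: cvgM; [exact: cvg_harmonic|exact: cvg_cst].
have cvgF : \int[mu]_x F n x @[n --> \oo] -->
   \int[mu]_x (chi 0 * (h x * m x * derive1 Psi x + (h x * derive1 m x + h1 x * m x) * Psi x)).
{ apply: (@Rintegral_dominated _ _ _ _ (fun x => `|h x * m x| * (D * B0 + B1) +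
     (`|h x * derive1 m x| + `|h1 x * m x|) * B0)) => //.
  - by move=> n; exact: rintegrable_measurable (jF n).
  - move=> x _.
    have c1 : X n x @[n --> \oo] --> chi 0.
      by apply: (cvg_comp _ chi (rcvg x)); exact: (smooth_continuous schi).
    have c2 : X' n x @[n --> \oo] --> 0 * derive1 chi 0.
      apply: cvgM; first exact: cvg_harmonic.
      by apply: (cvg_comp _ (derive1 chi) (rcvg x)); exact: (smooth_continuous (smoothS schi)).
    have c3 : F n x @[n --> \oo] --> h x * m x * (0 * derive1 chi 0 * Psi x + chi 0 * derive1 Psi x) +
        (h x * derive1 m x + h1 x * m x) * (chi 0 * Psi x).
      by apply: cvgD; apply: cvgM; try exact: cvg_cst; try (apply: cvgD; apply: cvgM => //; exact: cvg_cst);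
        apply: cvgM => //; exact: cvg_cst.
    rewrite (_ : chi 0 * _ = h x * m x * (0 * derive1 chi 0 * Psi x + chi 0 * derive1 Psi x) +
        (h x * derive1 m x + h1 x * m x) * (chi 0 * Psi x))//; ring.
  - apply: rintegrableD => //.
      exact: (rintegrableZr _ measurableT (rintegrable_norm jhm)).
    have jj := rintegrableD measurableT (rintegrable_norm jhm') (rintegrable_norm jh1m).
    exact: (rintegrableZr _ measurableT jj).
  - move=> n x _; rewrite /F (le_trans (ler_normD _ _))// lerD//.
      by rewrite normrM ler_wpM2l.
    by rewrite normrM ler_pM// ler_normD. }
have I0 : \int[mu]_x (chi 0 * (h x * m x * derive1 Psi x + (h x * derive1 m x + h1 x * m x) * Psi x)) = 0.
  apply: cvg_unique cvgF _ => //.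
  rewrite (_ : (fun _ => _) = fun=> 0); first exact: cvg_cst.
  by apply/funext => n; exact: F0.
have jA := rintegrableM measurableT jhm mPsi' (fun x _ => PB1 x).
have jB := rintegrableM measurableT (rintegrableD measurableT jhm' jh1m) (cmeas _ sPsi) (fun x _ => PB0 x).
have jAB := rintegrableD measurableT jA jB.
move: I0; rewrite RintegralZl// => /eqP; rewrite mulf_eq0 (negbTE chi0_neq0)/=.
by rewrite RintegralD// addr_eq0 => /eqP.
Qed.

End Admissible.

(** * The operator p d/dx and the pulled-back derivatives *)

Section Pullback.
Context {R : realType}.
Notation mu := (@lebesgue_measure R).
Variables (c : R) (rho : R -> R).

(** The polynomial p = (c^2 + x^2) / (2 c), for which phi' = p o phi. *)
Definition mobius_poly : {poly R} := ((c ^+ 2)%:P + 'X^2) * ((2 * c)^-1)%:P.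

Lemma mobius_polyE x : mobius_poly.[x] = (mobius_inv' c x)^-1.
Proof.
by rewrite hornerM hornerD !hornerC hornerXn /mobius_inv' invf_div.
Qed.

(** The coefficient of f^(k) in (p d/dx)^n (p rho f). *)
Fixpoint pull_coef n k : R -> R :=
  match n with
  | 0 => if k is 0 then fun x => mobius_poly.[x] * rho x else fun=> 0
  | n'.+1 => fun x => mobius_poly.[x] *
      (derive1 (pull_coef n' k) x + (if k is k'.+1 then pull_coef n' k' x else 0))
  end.

(** The function (p d/dx)^n (p rho f), when h k stands for the k-th weak
    derivative of f. *)
Definition pull n (h : nat -> R -> R) x : R :=
  \sum_(k < n.+1) h k x * pull_coef n k x.

Hypothesis hc : 0 < c.
Hypothesis hrho : schwartz_mon rho.

Let rho_gt0 x : 0 < rho x. Proof. by case: hrho. Qed.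
Let kpos x := mobius_inv'_gt0 hc x.

Lemma adm_pull_coef n k : admissible rho (pull_coef n k).
Proof.
elim: n k => [|n IH] k /=.
  case: k => [|k]; last exact: adm0.
  by apply: adm_mulp; exact: adm_weightfun.
apply: adm_mulp; apply: AdmAdd; first exact: (adm_derive1 hrho (IH k)).
by case: k => [|k]; [exact: adm0|exact: IH].
Qed.

Lemma pull_coef_gt n k : (n < k)%N -> pull_coef n k = fun=> 0.
Proof.
elim: n k => [|n IH] [|k]//= nk; apply/funext => x.
rewrite (IH k.+1 (ltnW nk)) (IH k nk) addr0.
by rewrite (is_derive1_derive1 (fun x => is_derive_cst (0 : R) x 1)) mulr0.
Qed.

(** The product rule for the derivative of [pull n h], with h k.+1 in place of
    the derivative of h k; the factor kappa' cancels p. *)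
Lemma pullS n h x : pull n.+1 h x * mobius_inv' c x =
  \sum_(k < n.+1) (h k x * derive1 (pull_coef n k) x + h k.+1 x * pull_coef n k x).
Proof.
rewrite /pull mulr_suml [RHS]big_split/=.
have E k : h k x * pull_coef n.+1 k x * mobius_inv' c x =
    h k x * derive1 (pull_coef n k) x +
    h k x * (if k is k'.+1 then pull_coef n k' x else 0).
  have k0 : mobius_inv' c x != 0 by rewrite gt_eqF.
  rewrite /= mobius_polyE; move: (match k with 0%N => _ | _ => _ end) => y.
  by field.
under eq_bigr do rewrite E.
rewrite big_split/=; congr (_ + _).
  rewrite big_ord_recr/= pull_coef_gt//.
  by rewrite (is_derive1_derive1 (fun x => is_derive_cst (0 : R) x 1)) mulr0 addr0.
by rewrite big_ord_recl/= mulr0 add0r.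
Qed.

Lemma mobius_inv'_le x : mobius_inv' c x <= 2 / c.
Proof.
rewrite /mobius_inv' ler_pdivrMr; last by rewrite ltr_wpDr ?sqr_ge0// exprn_gt0.
rewrite -mulrA ler_pM2l// mulrDr expr2 mulKf ?gt_eqF// lerDl.
by rewrite mulr_ge0 ?sqr_ge0// invr_ge0 ltW.
Qed.

(** The constant depends on the coefficients of [pull] alone, not on the
    functions they multiply; this is why the constants of the theorem are
    independent of f. *)
Lemma pull_bound n : exists2 C : R, 0 <= C & forall h x,
  pull n h x ^+ 2 * mobius_inv' c x <= C * \sum_(k < n.+1) h k x ^+ 2 * rho x.
Proof.
suff [C C0 HC] : exists2 C : R, 0 <= C & forall (h : nat -> R -> R) x,
    (\sum_(k < n.+1) h k x * pull_coef n k x) ^+ 2 <=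
    C * \sum_(k < n.+1) h k x ^+ 2 * rho x.
{ exists (C * (2 / c)); first by rewrite mulr_ge0// divr_ge0// ltW.
  move=> h x; rewrite [X in _ <= X]mulrAC; apply: ler_pM.
  - exact: sqr_ge0.
  - exact: ltW.
  - exact: HC.
  - exact: mobius_inv'_le. }
elim: n.+1 => [|m [C C0 HC]].
  by exists 0 => // h x; rewrite !big_ord0 expr0n mulr0.
have [D D0 HD] := adm_weight hrho 0 (adm_pull_coef n m).
exists (2 * C + 2 * D); first by apply: addr_ge0; exact: mulr_ge0.
move=> h x; rewrite !big_ord_recr/=.
have h1 := HC h x; have h2 := HD x; rewrite expr0 mulr1 in h2.
set S := \sum_(i < m) _ in h1 *; set S' := \sum_(i < m) _ in h1 *.
have S'0 : 0 <= S'.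
  by apply: sumr_ge0 => k _; apply: mulr_ge0; [exact: sqr_ge0|exact: ltW].
have h3 := ler_wpM2l (sqr_ge0 (h m x)) h2.
have H0 : 0 <= h m x ^+ 2 * rho x.
  by apply: mulr_ge0; [exact: sqr_ge0|exact: ltW].
rewrite (@le_trans _ _ (2 * S ^+ 2 + 2 * (h m x ^+ 2 * pull_coef n m x ^+ 2)))//.
  rewrite -subr_ge0 (_ : _ - _ = (S - h m x * pull_coef n m x) ^+ 2) ?sqr_ge0//.
  ring.
have h4 := mulr_ge0 C0 H0; have h5 := mulr_ge0 D0 S'0.
move: h1 h3 h4 h5; set u := S ^+ 2; set v := _ * pull_coef n m x ^+ 2.
rewrite [_ * (D * _)]mulrCA; set w := h m x ^+ 2 * rho x.
by rewrite mulrDr !mulrDl -!mulrA; lra.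
Qed.

Section Chain.
Variables (alpha : nat) (h : nat -> R -> R).
Hypothesis hL2 : forall k, (k <= alpha)%N -> weighted_L2 rho (h k).
Hypothesis weakh : forall k, (k < alpha)%N -> forall psi, test_fun setT psi ->
  \int[mu]_x (h k x * derive1 psi x) = - \int[mu]_x (h k.+1 x * psi x).

Lemma pull_rintegrable n : (n <= alpha)%N -> rintegrable setT (pull n h).
Proof.
move=> na; have [] := @rintegrable_sum _ setT n.+1 (fun k x => h k x * pull_coef n k x) measurableT.
  move=> k kn; apply: (weighted_L2_rintegrable hrho); last exact: adm_pull_coef.
  by apply: hL2; rewrite (leq_trans _ na).
by [].
Qed.

Lemma measurable_pull n : (n <= alpha)%N -> measurable_fun setT (pull n h).
Proof. by move=> na; exact: rintegrable_measurable (pull_rintegrable na). Qed.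

Lemma pull_ibp n Psi (B0 B1 : R) : (n < alpha)%N -> smooth Psi ->
  (forall x, `|Psi x| <= B0) -> (forall x, `|derive1 Psi x| <= B1) ->
  \int[mu]_x (pull n h x * derive1 Psi x) =
  - \int[mu]_x (pull n.+1 h x * mobius_inv' c x * Psi x).
Proof.
move=> na sPsi PB0 PB1.
have mPsi : measurable_fun setT Psi.
  by apply: continuous_measurable_fun; exact: (smooth_continuous sPsi).
have mPsi' : measurable_fun setT (derive1 Psi).
  by apply: continuous_measurable_fun; exact: (smooth_continuous (smoothS sPsi)).
have L2 k : (k < n.+1)%N -> weighted_L2 rho (h k).
  by move=> kn; apply: hL2; rewrite (leq_trans _ (ltnW na)).
have L2S k : (k < n.+1)%N -> weighted_L2 rho (h k.+1).
  by move=> kn; apply: hL2; rewrite (leq_trans _ na).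
have jhc k : (k < n.+1)%N -> rintegrable setT (fun x => h k x * pull_coef n k x).
  by move=> kn; apply: (weighted_L2_rintegrable hrho (L2 k kn)); exact: adm_pull_coef.
have jhc' k : (k < n.+1)%N -> rintegrable setT
    (fun x => h k x * derive1 (pull_coef n k) x + h k.+1 x * pull_coef n k x).
  move=> kn; apply: rintegrableD => //.
    apply: (weighted_L2_rintegrable hrho (L2 k kn)).
    by apply: (adm_derive1 hrho); exact: adm_pull_coef.
  apply: (weighted_L2_rintegrable hrho (L2S k kn)); exact: adm_pull_coef.
have [_ I1] := @rintegrable_sum _ setT n.+1
  (fun k x => h k x * pull_coef n k x * derive1 Psi x) measurableT
  (fun k kn => rintegrableM measurableT (jhc k kn) mPsi' (fun x _ => PB1 x)).
have [_ I2] := @rintegrable_sum _ setT n.+1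
  (fun k x => (h k x * derive1 (pull_coef n k) x + h k.+1 x * pull_coef n k x) * Psi x) measurableT
  (fun k kn => rintegrableM measurableT (jhc' k kn) mPsi (fun x _ => PB0 x)).
transitivity (\sum_(k < n.+1) \int[mu]_x (h k x * pull_coef n k x * derive1 Psi x)).
  by rewrite -I1; apply: eq_Rintegral => x _; rewrite /pull mulr_suml.
transitivity (- \sum_(k < n.+1) \int[mu]_x
   ((h k x * derive1 (pull_coef n k) x + h k.+1 x * pull_coef n k x) * Psi x)).
  rewrite -sumrN; apply: eq_bigr => k _.
  have kn := ltn_ord k.
  apply: (weak_ibp hrho (L2 k kn) (L2S k kn) _ (adm_pull_coef n k) sPsi PB0 PB1).
  by apply: weakh; rewrite (leq_trans kn).
rewrite -I2; congr (- _); apply: eq_Rintegral => x _.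
by rewrite pullS mulr_suml.
Qed.

Definition circle_pull n (t : R) : R := pull n h (mobius c t).

Lemma measurable_circle_pull n : (n <= alpha)%N ->
  measurable_fun circle_dom (circle_pull n).
Proof.
move=> na; apply: (measurableT_comp (measurable_pull na)).
exact: measurable_mobius.
Qed.

Lemma circle_pull_rintegrable n : (n <= alpha)%N ->
  rintegrable circle_dom (circle_pull n).
Proof.
move=> na; apply/(rintegrable_circle hc); first exact: measurable_circle_pull.
have mk := measurable_mobius_inv' hc.
have kb x : setT x -> `|mobius_inv' c x| <= 2 / c.
  by move=> _; rewrite gtr0_norm// mobius_inv'_le.
have jp := rintegrableM measurableT (pull_rintegrable na) mk kb.
by apply: eq_rintegrable jp => // x _; rewrite /circle_pull mobius_invK.
Qed.

(** Psi is not required to vanish at 0 and 2 pi, so this formula also carries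
    the boundary values of the pulled-back derivatives. *)
Lemma circle_pull_ibp n Psi (B0 B1 : R) : (n < alpha)%N -> smooth Psi ->
  (forall x, `|Psi x| <= B0) -> (forall x, `|derive1 Psi x| <= B1) ->
  \int[mu]_(t in circle_dom) (circle_pull n t * derive1 Psi t) =
  - \int[mu]_(t in circle_dom) (circle_pull n.+1 t * Psi t).
Proof.
move=> na sPsi PB0 PB1.
have cmeas f : smooth f -> measurable_fun (circle_dom : set R) f.
  move=> sf; apply: measurable_funTS; apply: continuous_measurable_fun.
  exact: (smooth_continuous sf).
pose Phi x := Psi (mobius_inv c x).
have sk := @smooth_mobius_inv R c.
have sPhi : smooth Phi by exact: (smooth_comp sPsi sk).
have dPhi x : derive1 Phi x = derive1 Psi (mobius_inv c x) * mobius_inv' c x.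
  rewrite derive1E; apply: derive_val.
  exact: (@is_derive1_chain _ Psi (mobius_inv c) x _ _ (smooth_is_derive _ sPsi)
    (is_derive_mobius_inv hc x)).
rewrite (Rintegral_circle hc); last first.
  exact: (measurable_funM (measurable_circle_pull (ltnW na)) (cmeas _ (smoothS sPsi))).
rewrite (Rintegral_circle hc); last first.
  exact: (measurable_funM (measurable_circle_pull na) (cmeas _ sPsi)).
have B1k x : `|derive1 Phi x| <= B1 * (2 / c).
  rewrite dPhi normrM ler_pM// gtr0_norm//; exact: mobius_inv'_le.
transitivity (\int[mu]_x (pull n h x * derive1 Phi x)).
  by apply: eq_Rintegral => x _; rewrite dPhi [in RHS]mulrA /circle_pull (mobius_invK hc).
rewrite (pull_ibp na sPhi (fun x => PB0 _) B1k).
congr (- _); apply: eq_Rintegral => x _.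
by rewrite /circle_pull (mobius_invK hc) /Phi mulrAC.
Qed.

End Chain.
End Pullback.

(** * Primitives on the circle *)

Section Antiderivative.
Context {R : realType}.
Notation mu := (@lebesgue_measure R).
Implicit Types w v psi : R -> R.

Let measurable_triangle : measurable [set z : measurableTypeR R * measurableTypeR R | z.2 <= z.1].
Proof.
rewrite (_ : [set _ | _] = (fun z : measurableTypeR R * measurableTypeR R => z.1 - z.2) @^-1` `[0, +oo[).
  rewrite -[X in measurable X]setTI.
  apply: (measurable_funB measurable_fst measurable_snd) => //.
by apply/seteqP; split => z /=; rewrite in_itv/= andbT subr_ge0.
Qed.

(** Fubini's theorem on the half-plane s <= t. *)
Lemma Rintegral_triangle w psi : rintegrable setT w -> rintegrable setT psi ->
  \int[mu]_t (psi t * \int[mu]_(s in `]-oo, t]) w s) =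
  \int[mu]_s (w s * \int[mu]_(t in `[s, +oo[) psi t).
Proof.
move=> jw jpsi.
pose T : set (measurableTypeR R * measurableTypeR R) := [set z | z.2 <= z.1].
pose k (z : measurableTypeR R * measurableTypeR R) : \bar R :=
  ((psi z.1 * w z.2) * \1_T z)%:E.
have mw := rintegrable_measurable jw; have mpsi := rintegrable_measurable jpsi.
have mk : measurable_fun setT k.
  apply/measurable_EFinP; apply: measurable_funM; last exact: measurable_indic.
  apply: measurable_funM.
    exact: (measurableT_comp mpsi measurable_fst).
  exact: (measurableT_comp mw measurable_snd).
have ind_le z : `|\1_T z : R| <= 1.
  by rewrite indicE; case: (_ \in _); rewrite ?normr1 ?normr0.
have EI (D : set (measurableTypeR R)) f : measurable D -> rintegrable D f ->
    (\int[mu]_(x in D) (f x)%:E = (\int[mu]_(x in D) f x)%:E)%E.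
  by move=> mD jf; rewrite /Rintegral fineK//; exact: integrable_fin_num.
have inner1 t : (\int[mu]_s k (t, s) = (psi t * \int[mu]_(s in `]-oo, t]) w s)%:E)%E.
  have jwt : rintegrable setT (w \_ `]-oo, t]).
    by apply: rintegrable_patch => //; exact: rintegrableS jw.
  rewrite Rintegral_mkcond -RintegralZl// -EI//; last exact: rintegrableZ.
  apply: eq_integral => s _; rewrite /k /= indicE patchE; congr (_%:E).
  have -> : ((t, s) \in T) = (s \in `]-oo, t]%classic).
    by apply/idP/idP; rewrite !inE /T/= ?in_itv.
  by case: ifPn => _; rewrite ?mulr1 ?mulr0.
have inner2 s : (\int[mu]_t k (t, s) = (w s * \int[mu]_(t in `[s, +oo[) psi t)%:E)%E.
  have jpt : rintegrable setT (psi \_ `[s, +oo[).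
    by apply: rintegrable_patch => //; exact: rintegrableS jpsi.
  rewrite Rintegral_mkcond -RintegralZl// -EI//; last exact: rintegrableZ.
  apply: eq_integral => t _; rewrite /k /= indicE patchE; congr (_%:E).
  have -> : ((t, s) \in T) = (t \in `[s, +oo[%classic).
    by apply/idP/idP; rewrite !inE /T/= ?in_itv/= ?andbT.
  by case: ifPn => _; rewrite ?mulr1 ?mulr0// mulrC.
have jk : (mu \x mu)%E.-integrable setT k.
{ apply/(integrable12ltyP mu mu mk).
  pose W := \int[mu]_s `|w s|.
  have jW := rintegrableZr W measurableT (rintegrable_norm jpsi).
  apply: (@le_lt_trans _ _ (\int[mu]_t (`|psi t| * W)%:E)%E); last first.
    by rewrite EI// ltry.
  apply: ge0_le_integral => //.
  - by move=> t _; apply: integral_ge0.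
  - have mak : measurable_fun setT (abse \o k) by exact: measurableT_comp.
    exact: (@measurable_fun_fubini_tonelli_F _ _ _ _ _ mu (abse \o k) mak (fun=> abse_ge0 _)).
  - exact: measurable_int jW.
  - move=> t _; rewrite -RintegralZl//; last exact: rintegrable_norm.
    rewrite -EI//; last exact: (rintegrableZ _ measurableT (rintegrable_norm jw)).
    apply: ge0_le_integral => //.
    + apply: measurableT_comp => //; exact: (measurableT_comp mk (measurable_pair1 t)).
    + apply/measurable_EFinP; apply: measurable_funM => //; exact: measurableT_comp.
    + by move=> s _; rewrite lee_fin !normrM ler_piMr// mulr_ge0. }
have := Fubini jk.
under eq_integral do rewrite inner1.
under [in RHS]eq_integral do rewrite inner2.
by move=> E; rewrite /Rintegral E.
Qed.

(** Extending v by 0 outside [circle_dom] makes this function constant beyond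
    2 pi and lets Fubini's theorem be used on the whole line. *)
Definition primitive v (t : R) : R :=
  parameterized_integral mu 0 t (v \_ (circle_dom : set R)).

Lemma test_fun_rintegrable (U : set R) psi : test_fun U psi -> rintegrable setT psi.
Proof.
move=> [spsi [K [cK KU psi0]]].
have lpsi : locally_integrable setT (cst 1 : R -> R).
  split; [exact: measurable_cst|exact: openT|move=> L _ cL].
  have : rintegrable L (cst 1 : R -> R).
    by apply: continuous_compact_integrable => //; apply: continuous_subspaceT; exact: cst_continuous.
  by case/integrableP.
have := locally_rintegrable_test lpsi cK (@subsetT _ _) (smooth_continuous spsi) psi0.
by apply: eq_rintegrable => // x _; rewrite mul1r.
Qed.

Section Primitive.
Variable v : R -> R.
Hypothesis jv : rintegrable circle_dom v.

Let jw : rintegrable setT (v \_ (circle_dom : set R)).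
Proof. by apply: rintegrable_patch => //; exact: measurable_circle_dom. Qed.

Lemma primitiveE t : primitive v t = \int[mu]_(s in `]-oo, t]) (v \_ (circle_dom : set R)) s.
Proof.
rewrite /primitive /parameterized_integral [LHS]Rintegral_mkcond [RHS]Rintegral_mkcond.
apply: eq_Rintegral => s _; rewrite !patchE.
case: (boolP (s \in (circle_dom : set R))) => hs; last by do 2 case: ifP.
suff -> : (s \in (`[0, t]%classic : set R)) = (s \in (`]-oo, t]%classic : set R)) by [].
move: hs; rewrite !mem_setE /circle_dom /= !in_itv/= => /andP[s0 _].
by rewrite (ltW s0).
Qed.

Lemma primitive_within : {within `[0, 2 * pi], continuous (primitive v)}.
Proof.
apply: parameterized_integral_continuous; first by rewrite mulr_ge0// pi_ge0.
by apply: integrableS jw.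
Qed.

Lemma primitive0 : primitive v 0 = 0.
Proof. by rewrite /primitive /parameterized_integral set_itv1 Rintegral_set1. Qed.

Lemma primitive2pi : primitive v (2 * pi) = \int[mu]_(t in circle_dom) v t.
Proof.
rewrite /primitive /parameterized_integral [LHS]Rintegral_mkcond [RHS]Rintegral_mkcond.
apply: eq_Rintegral => s _; rewrite !patchE.
case: ifPn => //; rewrite mem_setE/= => h1; case: ifPn => // /set_mem h2.
by move: h1; rewrite (subset_itv_oo_cc h2).
Qed.

Lemma primitive_in_continuous : {in (circle_dom : set R), continuous (primitive v)}.
Proof.
have p0 : 0 < 2 * pi :> R by rewrite mulr_gt0// pi_gt0.
have /(continuous_within_itvP _ p0)[+ _ _] := primitive_within.
by move=> h x; rewrite inE => hx; apply: h.
Qed.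

Lemma primitive_cvg0 : primitive v t @[t --> 0^'+] --> (0 : R).
Proof.
have p0 : 0 < 2 * pi :> R by rewrite mulr_gt0// pi_gt0.
have /(continuous_within_itvP _ p0)[_ + _] := primitive_within.
by rewrite primitive0.
Qed.

Lemma primitive_cvg2pi :
  primitive v t @[t --> (2 * pi)^'-] --> \int[mu]_(t in circle_dom) v t.
Proof.
have p0 : 0 < 2 * pi :> R by rewrite mulr_gt0// pi_gt0.
have /(continuous_within_itvP _ p0)[_ _ +] := primitive_within.
by rewrite primitive2pi.
Qed.

Lemma primitive_rintegrable : rintegrable circle_dom (primitive v).
Proof.
have := continuous_compact_integrable (@segment_compact _ _ _) primitive_within.
apply: integrableS; [exact: measurable_itv|exact: measurable_circle_dom|].
by move=> x; exact: subset_itv_oo_cc.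
Qed.

(** An antiderivative of - psi. For a test function psi it is smooth and
    bounded with bounded derivative, which is all that [circle_pull_ibp] asks
    for, but it need not vanish near 0. *)
Definition tail psi (s : R) : R := \int[mu]_(t in `[s, +oo[) psi t.

Lemma primitive_tail psi : test_fun (circle_dom : set R) psi ->
  \int[mu]_(t in circle_dom) (primitive v t * psi t) =
  \int[mu]_(s in circle_dom) (v s * tail psi s).
Proof.
move=> tpsi; have jpsi := test_fun_rintegrable tpsi.
have [spsi [K [cK KU psi0]]] := tpsi.
have := Rintegral_triangle jw jpsi.
rewrite (_ : \int[mu]_t _ = \int[mu]_(t in circle_dom) (primitive v t * psi t)).
  move=> ->; rewrite [RHS]Rintegral_mkcond; apply: eq_Rintegral => s _.
  by rewrite !patchE; case: ifPn => // _; rewrite mul0r.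
rewrite [RHS]Rintegral_mkcond; apply: eq_Rintegral => t _.
rewrite patchE -primitiveE; case: ifPn; first by rewrite mulrC.
rewrite notin_setE => tU; rewrite psi0 ?mul0r// => Kt; exact/tU/KU.
Qed.

Lemma tail_smooth (U : set R) psi : test_fun U psi ->
  [/\ smooth (tail psi), forall x, derive1 (tail psi) x = - psi x &
      exists M : R, forall x, `|tail psi x| <= M].
Proof.
move=> tpsi; have jpsi := test_fun_rintegrable tpsi.
have [spsi _] := tpsi; have cpsi := smooth_continuous spsi.
pose F x := \int[mu]_(t in `]-oo, x]) psi t.
have jD (D : set (measurableTypeR R)) : measurable D -> rintegrable D psi.
  by move=> mD; exact: integrableS jpsi.
have tE x : tail psi x = \int[mu]_t psi t - F x.
{ rewrite /F -Rintegral_itv_bndo_bndc; last exact: jD.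
  apply/eqP; rewrite -subr_eq opprK addrC; apply/eqP.
  rewrite /tail -Rintegral_setU//.
  - by congr Rintegral; rewrite -itv_bndbnd_setU// ; exact: set_itvNyy.
  - by apply: jD; apply: measurableU.
  - apply/disj_setPS => z [/=]; rewrite !in_itv/= andbT => h1 h2.
    by move: h1; rewrite ltNge h2. }
have dF (x : R) : is_derive x 1 F (psi x).
{ have [] := @continuous_FTC1 R psi -oo%O x (x + 1) _ (jD _ (measurable_itv _)) _ (cpsi x).
  - by rewrite ltrDl.
  - by rewrite ltNyr.
  - by move=> dF <-; exact: derivable_is_derive1. }
have dt (x : R) : is_derive x 1 (tail psi) (- psi x).
  rewrite (funext tE).
  have := is_derive1D (is_derive_cst (\int[mu]_t psi t) x 1) (is_derive1N (dF x)).
  by rewrite add0r.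
split.
- apply: (smooth_antiderivative dt); exact: smoothN.
- by move=> x; rewrite (is_derive1_derive1 dt).
- exists (\int[mu]_t `|psi t|) => x; rewrite /tail.
  apply: le_trans; first by apply: le_normr_Rintegral => //; exact: jD.
  have jn := rintegrable_norm jpsi.
  rewrite [X in X <= _]Rintegral_mkcond; apply: le_Rintegral => //.
  + by apply: rintegrable_patch => //; exact: rintegrableS jn.
  + by move=> t _; rewrite patchE; case: ifPn => // _; exact: (normr_ge0 (psi t)).
Qed.

End Primitive.
End Antiderivative.

(** * Weak derivatives of the pull-back: real case *)

Section PullbackWeak.
Context {R : realType}.
Notation mu := (@lebesgue_measure R).
Variables (c : R) (rho : R -> R).
Hypothesis hc : 0 < c.
Hypothesis hrho : schwartz_mon rho.
Variables (alpha : nat) (f : R -> R) (h : nat -> R -> R).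
Hypothesis hL2 : forall k, (k <= alpha)%N -> weighted_L2 rho (h k).
Hypothesis weakh : forall k, (k < alpha)%N -> forall psi, test_fun setT psi ->
  \int[mu]_x (h k x * derive1 psi x) = - \int[mu]_x (h k.+1 x * psi x).
Hypothesis mf : measurable_fun setT f.
Hypothesis weak0 : forall psi, test_fun setT psi ->
  \int[mu]_x (f x * psi x) = \int[mu]_x (h 0%N x * psi x).

Let g (t : R) : R := f (mobius c t) * rho (mobius c t) * derive1 (mobius c) t.
Let srho : smooth rho. Proof. by case: hrho => -[]. Qed.

Lemma derive1_mobius t : circle_dom t ->
  derive1 (mobius c) t = (mobius_inv' c (mobius c t))^-1.
Proof.
by move=> ht; rewrite derive1E; apply: derive_val; exact: is_derive_mobius.
Qed.

Lemma measurable_derive1_mobius : measurable_fun circle_dom (derive1 (mobius c)).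
Proof.
have mp : measurable_fun setT (fun x => (mobius_poly c).[x]).
  apply: continuous_measurable_fun; apply: derivable1_cts => x.
  by have := is_derive_poly (mobius_poly c) x; case.
apply: (eq_measurable_fun (fun t => (mobius_poly c).[mobius c t])).
  by move=> t; rewrite inE => ht; rewrite derive1_mobius// mobius_polyE.
by apply: (measurableT_comp mp); exact: measurable_mobius.
Qed.

Lemma measurable_pulled : measurable_fun circle_dom g.
Proof.
apply: measurable_funM; last exact: measurable_derive1_mobius.
apply: measurable_funM.
  by apply: (measurableT_comp mf); exact: measurable_mobius.
apply: (@measurableT_comp _ _ _ _ _ _ rho); last exact: measurable_mobius.
by apply: continuous_measurable_fun; exact: (smooth_continuous srho).
Qed.

Lemma test_fun_pull (m psi : R -> R) : smooth m -> test_fun circle_dom psi ->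
  test_fun setT (fun x => m x * psi (mobius_inv c x)).
Proof.
move=> sm [spsi [K [cK KU psi0]]]; split.
  by apply: smoothM; [exact: sm|exact: (smooth_comp spsi (@smooth_mobius_inv R c))].
exists (mobius c @` K); split => //.
- apply: continuous_compact => //; apply: continuous_in_subspaceT => t.
  by rewrite inE => /KU ht; apply: mobius_continuous; rewrite ?inE.
- move=> x xK; rewrite psi0 ?mulr0// => Kx; apply: xK.
  by exists (mobius_inv c x) => //; exact: mobius_invK.
Qed.

(** The substitution t = kappa x for n = 0, then one integration by parts for
    each further derivative. *)
Lemma circle_pull_weak n psi : (n <= alpha)%N -> test_fun circle_dom psi ->
  \int[mu]_(t in circle_dom) (g t * derive1n n psi t) =
  (-1) ^+ n * \int[mu]_(t in circle_dom) (circle_pull c rho h n t * psi t).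
Proof.
have mtest p : test_fun circle_dom p -> measurable_fun (circle_dom : set R) p.
  move=> [sp _]; apply: measurable_funTS; apply: continuous_measurable_fun.
  exact: (smooth_continuous sp).
elim: n psi => [|n IH] psi na tpsi.
  rewrite expr0 mul1r (Rintegral_circle hc); last first.
    by apply: (measurable_funM measurable_pulled); exact: mtest.
  rewrite [RHS](Rintegral_circle hc); last first.
    apply: measurable_funM; last exact: mtest.
    exact: (measurable_circle_pull hc hrho hL2).
  have tp := test_fun_pull srho tpsi.
  have k0 x : mobius_inv' c x != 0 by rewrite gt_eqF// mobius_inv'_gt0.
  transitivity (\int[mu]_x (f x * (rho x * psi (mobius_inv c x)))).
    apply: eq_Rintegral => x _; rewrite /g (mobius_invK hc).
    rewrite derive1_mobius ?(mobius_invK hc)//; last exact: mobius_inv_circle.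
    by rewrite derive1n0; have := k0 x; move: (mobius_inv' c x) (psi _) => a b a0; field.
  rewrite weak0//; apply: eq_Rintegral => x _.
  rewrite /circle_pull (mobius_invK hc) /pull big_ord_recl big_ord0 addr0 /=.
  by rewrite mobius_polyE; have := k0 x; move: (mobius_inv' c x) (psi _) => a b a0; field.
have tpsi' := test_fun_derive1 tpsi.
have [B0 _ PB0] := test_fun_bounded tpsi; have [B1 _ PB1] := test_fun_bounded tpsi'.
rewrite derive1Sn IH//; last exact: ltnW.
rewrite (circle_pull_ibp hc hrho hL2 weakh na _ PB0 PB1); last by case: tpsi.
by rewrite exprS mulN1r mulrN mulNr.
Qed.

(** Integration by parts with Psi = [tail psi], combined with
    [primitive_tail]. *)
Lemma primitive_circle_pull n psi : (n < alpha)%N -> test_fun circle_dom psi ->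
  \int[mu]_(t in circle_dom) (primitive (circle_pull c rho h n.+1) t * psi t) =
  \int[mu]_(t in circle_dom) (circle_pull c rho h n t * psi t).
Proof.
move=> na tpsi.
have jv := circle_pull_rintegrable hc hrho hL2 na.
have [st dt [M tM]] := tail_smooth tpsi.
have [B1 _ PB1] := test_fun_bounded tpsi.
rewrite (primitive_tail jv tpsi).
have PB x : `|derive1 (tail psi) x| <= B1 by rewrite dt normrN.
have E := circle_pull_ibp hc hrho hL2 weakh na st tM PB.
rewrite -[LHS]opprK -E -[RHS]opprK; congr (- _).
rewrite -mulN1r -RintegralZl//.
- by apply: eq_Rintegral => t _; rewrite dt mulN1r mulrN.
- exact: measurable_circle_dom.
- have jn := circle_pull_rintegrable hc hrho hL2 (ltnW na).
  apply: (rintegrableM measurable_circle_dom jn _ (fun x _ => PB1 x)).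
  apply: measurable_funTS; apply: continuous_measurable_fun.
  by apply: smooth_continuous; case: tpsi.
Qed.

(** Integration by parts against the constant 1; this is what makes the
    primitive of the next derivative vanish at 2 pi. *)
Lemma circle_pull_mean0 n : (n < alpha)%N ->
  \int[mu]_(t in circle_dom) circle_pull c rho h n.+1 t = 0.
Proof.
move=> na; have b1 (x : R) : `|(fun=> 1 : R) x : R| <= 1 by rewrite normr1.
have d1 (x : R) : derive1 (fun=> 1 : R) x = 0 :> R.
  by rewrite (is_derive1_derive1 (fun x => is_derive_cst (1 : R) x 1)).
have b0 (x : R) : `|derive1 (fun=> 1 : R) x| <= (0 : R) by rewrite d1 normr0.
have := circle_pull_ibp hc hrho hL2 weakh na (smooth_cst 1) b1 b0.
under eq_Rintegral do rewrite d1 mulr0.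
under [in RHS]eq_Rintegral do rewrite mulr1.
rewrite Rintegral_cst ?mul0r; last exact: measurable_circle_dom.
by move/eqP; rewrite eq_sym oppr_eq0 => /eqP.
Qed.

End PullbackWeak.

(** * Complex weak derivatives *)

Section WeakDerivatives.
Context {R : realType}.
Notation mu := (@lebesgue_measure R).
Notation Re := complex.Re.
Notation Im := complex.Im.
Notation normc := ComplexField.Normc.normc.
Implicit Types (U : set R) (z : R[i]).

Lemma normc_sqr z : normc z `^ 2 = Re z ^+ 2 + Im z ^+ 2.
Proof.
case: z => a b; rewrite powR_mulrn; last exact: sqrtr_ge0.
by rewrite /= sqr_sqrtr// addr_ge0// sqr_ge0.
Qed.

Lemma Re_mulrc z (r : R) : Re (z * r%:C) = Re z * r.
Proof. by case: z => a b /=; rewrite mulr0 subr0. Qed.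

Lemma Im_mulrc z (r : R) : Im (z * r%:C) = Im z * r.
Proof. by case: z => a b /=; rewrite mulr0 add0r. Qed.

Lemma complex_scale (r a b : R) : r%:C * (a +i* b) = (r * a) +i* (r * b).
Proof. by apply/eqP; rewrite eq_complex/= !mul0r subr0 addr0 !eqxx. Qed.

Definition real_weak_deriv U n (f h : R -> R) :=
  [/\ locally_integrable U f, locally_integrable U h &
      forall psi, test_fun U psi ->
        \int[mu]_(x in U) (f x * derive1n n psi x) =
        (-1) ^+ n * \int[mu]_(x in U) (h x * psi x)].

Lemma weak_derivP U n (f h : R -> R[i]) : weak_deriv U n f h <->
  real_weak_deriv U n (fun x => Re (f x)) (fun x => Re (h x)) /\
  real_weak_deriv U n (fun x => Im (f x)) (fun x => Im (h x)).
Proof.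
have CI (k : R -> R[i]) psi : Cintegral U (fun x => k x * (psi x)%:C) =
    (\int[mu]_(x in U) (Re (k x) * psi x)) +i* (\int[mu]_(x in U) (Im (k x) * psi x)).
  by rewrite /Cintegral; congr (_ +i* _); apply: eq_Rintegral => x _;
    rewrite ?Re_mulrc ?Im_mulrc.
have signE : (-1) ^+ n = ((-1) ^+ n : R)%:C :> R[i] by rewrite rmorphXn rmorphN1.
split.
- case=> -[fr fi] [hr hi] w; split; split => // psi tpsi;
    by have := w psi tpsi; rewrite !CI signE complex_scale => -[].
- case=> -[fr hr wr] [fi hi wi]; split => // psi tpsi.
  by rewrite !CI signE complex_scale wr// wi.
Qed.

Lemma wderivP U n (f : R -> R[i]) :
  (exists h, weak_deriv U n f h) -> weak_deriv U n f (wderiv U n f).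
Proof. by move=> ex; exact: (@xgetPex _ (fun=> 0) [set h | weak_deriv U n f h]). Qed.

Lemma real_weak_deriv_ae (A B : R) n (f h k : R -> R) :
  real_weak_deriv `]A, B[ n f h -> real_weak_deriv `]A, B[ n f k ->
  {ae mu, forall x, `]A, B[%classic x -> h x = k x}.
Proof.
move=> [_ lh wh] [_ lk wk].
have lD : locally_integrable `]A, B[ (fun x => h x - k x).
  have := locally_integrableB lh lk; exact.
have ortho psi : test_fun `]A, B[ psi ->
    \int[mu]_(x in `]A, B[) ((h x - k x) * psi x) = 0.
  move=> tpsi; have [sp [K [cK KU psi0]]] := tpsi.
  have jh := locally_rintegrable_test lh cK KU (smooth_continuous sp) psi0.
  have jk := locally_rintegrable_test lk cK KU (smooth_continuous sp) psi0.
  under eq_Rintegral do rewrite mulrBl.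
  rewrite RintegralB//; apply/eqP; rewrite subr_eq0; apply/eqP.
  by apply: (mulfI (negbT (signr_eq0 R n))); rewrite -wh// -wk.
have [N [mN N0 sub]] := test_ortho_ae lD ortho; exists N; split => //.
apply: subset_trans sub => x /= + hx; apply => Ux.
by have /eqP := hx Ux; rewrite subr_eq0 => /eqP.
Qed.

(** Both sides test f against the derivative of order n + 1 of psi. *)
Lemma real_weak_deriv_succ n (u h h1 : R -> R) psi :
  real_weak_deriv setT n u h -> real_weak_deriv setT n.+1 u h1 ->
  test_fun setT psi ->
  \int[mu]_x (h x * derive1 psi x) = - \int[mu]_x (h1 x * psi x).
Proof.
move=> [_ _ wh] [_ _ wh1] tpsi.
apply: (mulfI (negbT (signr_eq0 R n))); rewrite -wh; last exact: test_fun_derive1.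
by rewrite -derive1Sn wh1// exprS mulN1r mulrN mulNr.
Qed.

Lemma cvg_complex {T : Type} (F : set_system T) {FF : Filter F} (u v : T -> R) (a b : R) :
  u x @[x --> F] --> a -> v x @[x --> F] --> b ->
  (u x +i* v x) @[x --> F] --> (a +i* b : R[i]).
Proof.
move=> ua vb; apply/cvgrPdist_lt => e; rewrite ltcE/= => /andP[/eqP Ie Re0].
have e20 : 0 < Re e / 2 by rewrite divr_gt0.
have /cvgrPdist_lt/(_ _ e20) nu := ua.
have /cvgrPdist_lt/(_ _ e20) nv := vb.
near=> x.
have hu : `|a - u x| < Re e / 2 by near: x.
have hv : `|b - v x| < Re e / 2 by near: x.
rewrite normc_def/= ltcE/= Ie eqxx/=.
have -> : Re e = Num.sqrt (Re e ^+ 2) by rewrite sqrtr_sqr gtr0_norm.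
rewrite ltr_sqrt ?exprn_gt0//.
have hu2 : (a - u x) ^+ 2 < (Re e / 2) ^+ 2.
  by rewrite -real_normK ?num_real// ltr_pXn2r ?nnegrE// ltW.
have hv2 : (b - v x) ^+ 2 < (Re e / 2) ^+ 2.
  by rewrite -real_normK ?num_real// ltr_pXn2r ?nnegrE// ltW.
have := ltrD hu2 hv2; move/lt_le_trans; apply.
rewrite expr_div_n -mulrDr -[X in _ <= X]mulr1 ler_wpM2l ?sqr_ge0//.
lra.
Unshelve. all: by end_near. Qed.

Lemma norm_lt_Re_Im (z e : R[i]) : `|z| < e -> `|Re z| < Re e /\ `|Im z| < Re e.
Proof.
rewrite normc_def ltcE/= => /andP[_]; move: (Re e) => r.
have sq (a b : R) : `|a| <= Num.sqrt (a ^+ 2 + b ^+ 2).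
  by rewrite -sqrtr_sqr ler_wsqrtr// lerDl sqr_ge0.
move=> h; split; apply: le_lt_trans h => //; rewrite addrC; exact: sq.
Qed.

Lemma continuous_Re (f : R -> R[i]) : continuous f -> continuous (fun x => Re (f x)).
Proof.
move=> cf x; apply/cvgrPdist_lt => e e0.
have e0' : 0 < e%:C :> R[i] by rewrite ltcE/= eqxx.
have /cvgrPdist_lt/(_ _ e0') := cf x.
by apply: filterS => y /norm_lt_Re_Im[]; case: (f x) (f y) => [a b] [a' b'].
Qed.

Lemma continuous_Im (f : R -> R[i]) : continuous f -> continuous (fun x => Im (f x)).
Proof.
move=> cf x; apply/cvgrPdist_lt => e e0.
have e0' : 0 < e%:C :> R[i] by rewrite ltcE/= eqxx.
have /cvgrPdist_lt/(_ _ e0') := cf x.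
by apply: filterS => y /norm_lt_Re_Im[]; case: (f x) (f y) => [a b] [a' b'].
Qed.

End WeakDerivatives.

(** * Pull-back of a continuous function *)

Section RealPullback.
Context {R : realType}.
Notation mu := (@lebesgue_measure R).
Variables (c : R) (rho : R -> R).
Hypothesis hc : 0 < c.
Hypothesis hrho : schwartz_mon rho.
Variables (alpha : nat) (f : R -> R) (h : nat -> R -> R).
Hypothesis cf : continuous f.
Hypothesis hL2 : forall k, (k <= alpha)%N -> weighted_L2 rho (h k).
Hypothesis wh : forall k, (k <= alpha)%N -> real_weak_deriv setT k f (h k).

Let g (t : R) : R := f (mobius c t) * rho (mobius c t) * derive1 (mobius c) t.

Let mf : measurable_fun setT f.
Proof. exact: continuous_measurable_fun. Qed.

Let weakh k : (k < alpha)%N -> forall psi, test_fun setT psi ->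
  \int[mu]_x (h k x * derive1 psi x) = - \int[mu]_x (h k.+1 x * psi x).
Proof. by move=> ka psi; exact: (real_weak_deriv_succ (wh (ltnW ka)) (wh ka)). Qed.

Let weak0 psi : test_fun setT psi ->
  \int[mu]_x (f x * psi x) = \int[mu]_x (h 0%N x * psi x).
Proof.
move=> tpsi; have [_ _ w] := wh (leq0n alpha); have := w _ tpsi.
by rewrite derive1n0 expr0 mul1r.
Qed.

Let ocirc : open (circle_dom : set R).
Proof. exact: interval_open. Qed.

(** The pull-back of a continuous function is continuous on the open circle,
    hence bounded on its compact subsets. *)
Lemma locally_integrable_pulled : locally_integrable circle_dom g.
Proof.
split; [exact: measurable_pulled|exact: ocirc|move=> K KU cK].
suff : rintegrable K g by case/integrableP.
apply: (@eq_rintegrable _ _ (fun t => f (mobius c t) * rho (mobius c t) * (mobius_poly c).[mobius c t])).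
- exact: compact_measurable.
- move=> t; rewrite inE => /KU ht; rewrite /g derive1_mobius// mobius_polyE//.
- apply: continuous_compact_integrable => //.
  apply: continuous_in_subspaceT => t; rewrite inE => /KU ht.
  have ct : {for t, continuous (mobius c)} by apply: mobius_continuous; rewrite ?inE.
  have crho : continuous rho by apply: smooth_continuous; case: hrho => -[].
  have cp : continuous (fun x => (mobius_poly c).[x]).
    by apply: derivable1_cts => x; have := is_derive_poly (mobius_poly c) x; case.
  apply: (@continuousM _ _ (fun t => f (mobius c t) * rho (mobius c t)) (fun t => (mobius_poly c).[mobius c t])).
    apply: (@continuousM _ _ (fun t => f (mobius c t)) (fun t => rho (mobius c t))).
      by apply: continuous_comp => //; exact: cf.
    by apply: continuous_comp => //; exact: crho.
  apply: (@continuous_comp _ _ _ (mobius c) (fun x => (mobius_poly c).[x])) => //; exact: cp.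
Qed.

Lemma circle_pull_weak_deriv n : (n <= alpha)%N ->
  real_weak_deriv circle_dom n g (circle_pull c rho h n).
Proof.
move=> na; split; first exact: locally_integrable_pulled.
- apply: open_integrable_locally => //; exact: (circle_pull_rintegrable hc hrho hL2 na).
- by move=> psi; exact: (circle_pull_weak hc hrho hL2 weakh mf weak0).
Qed.

Lemma primitive_weak_deriv n : (n < alpha)%N ->
  real_weak_deriv circle_dom n g (primitive (circle_pull c rho h n.+1)).
Proof.
move=> na; have [lg _ w] := circle_pull_weak_deriv (ltnW na); split => //.
- apply: open_integrable_locally => //; apply: primitive_rintegrable.
  exact: (circle_pull_rintegrable hc hrho hL2 na).
- move=> psi tpsi; rewrite w//; congr (_ * _); apply/esym.
  exact: (primitive_circle_pull hc hrho hL2 weakh).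
Qed.

Lemma primitive_pull_cvg2pi n : (n < alpha)%N ->
  primitive (circle_pull c rho h n.+1) t @[t --> (2 * pi)^'-] --> (0 : R).
Proof.
move=> na; rewrite -(circle_pull_mean0 hc hrho hL2 weakh na).
by apply: primitive_cvg2pi; exact: (circle_pull_rintegrable hc hrho hL2 na).
Qed.

Lemma primitive_pull2pi n : (n < alpha)%N ->
  primitive (circle_pull c rho h n.+1) (2 * pi) = 0.
Proof.
by move=> na; rewrite primitive2pi (circle_pull_mean0 hc hrho hL2 weakh na).
Qed.

End RealPullback.

(** * Norms and boundary values of the pull-back *)

Section ComplexPullback.
Context {R : realType}.
Notation mu := (@lebesgue_measure R).
Notation Re := complex.Re.
Notation Im := complex.Im.
Notation normc := ComplexField.Normc.normc.
Variables (c : R) (rho : R -> R).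
Hypothesis hc : 0 < c.
Hypothesis hrho : schwartz_mon rho.
Variables (alpha : nat) (f : R -> R[i]).
Hypothesis hf : sobolev alpha 2 rho f.
Hypothesis hfc : continuous f.

Let fk k := wderiv setT k f.
Let fr k x := Re (fk k x).
Let fi k x := Im (fk k x).
Let g := mobius_pullback c rho f.

Let rho_gt0 x : 0 < rho x. Proof. by case: hrho. Qed.
Let mrho : measurable_fun setT rho.
Proof.
by apply: continuous_measurable_fun; apply: smooth_continuous; case: hrho => -[].
Qed.

Definition energy k : \bar R := (\int[mu]_x (normc (fk k x) `^ 2 * rho x)%:E)%E.

(** The square of the Sobolev norm of f. *)
Definition total_energy : \bar R := (\sum_(0 <= k < alpha.+1) energy k)%E.

Lemma energy_ge0 k : (0 <= energy k)%E.
Proof.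
by apply: integral_ge0 => x _; rewrite lee_fin mulr_ge0 ?powR_ge0// ltW.
Qed.

Lemma total_energy_lty : (total_energy < +oo)%E.
Proof. by have [_] := hf; apply: lty_poweRy; rewrite invr_neq0. Qed.

Lemma sum_energy_le n : (n <= alpha)%N ->
  (\sum_(0 <= k < n.+1) energy k <= total_energy)%E.
Proof.
by move=> na; apply: lee_sum_nneg_natr => // k _ _; exact: energy_ge0.
Qed.

Lemma energy_lty k : (k <= alpha)%N -> (energy k < +oo)%E.
Proof.
move=> ka; apply: le_lt_trans total_energy_lty.
apply: le_trans (sum_energy_le ka); rewrite big_nat_recr//= leeDr//.
by apply: sume_ge0 => j _; exact: energy_ge0.
Qed.

Let wf k : (k <= alpha)%N -> weak_deriv setT k f (fk k).
Proof. by move=> ka; apply: wderivP; have [+ _] := hf; apply. Qed.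

Let wr k : (k <= alpha)%N -> real_weak_deriv setT k (fun x => Re (f x)) (fr k).
Proof. by move=> /wf/weak_derivP[]. Qed.

Let wi k : (k <= alpha)%N -> real_weak_deriv setT k (fun x => Im (f x)) (fi k).
Proof. by move=> /wf/weak_derivP[]. Qed.

Let mr k : (k <= alpha)%N -> measurable_fun setT (fr k).
Proof. by move=> /wr[_ []]. Qed.

Let mi k : (k <= alpha)%N -> measurable_fun setT (fi k).
Proof. by move=> /wi[_ []]. Qed.

Let menergy k : (k <= alpha)%N ->
  measurable_fun setT (fun x => (normc (fk k x) `^ 2 * rho x)%:E).
Proof.
move=> ka; apply/measurable_EFinP; apply: measurable_funM; last exact: mrho.
apply: (eq_measurable_fun (fun x => fr k x ^+ 2 + fi k x ^+ 2)).
  by move=> x _; rewrite normc_sqr.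
by apply: measurable_funD; apply: measurable_funX; [exact: mr|exact: mi].
Qed.

Let component_L2 k (u : R -> R) : (k <= alpha)%N -> measurable_fun setT u ->
  (forall x, u x ^+ 2 <= normc (fk k x) `^ 2) -> weighted_L2 rho u.
Proof.
move=> ka mu_ ule; split => //.
have mur : measurable_fun setT (fun x => (u x ^+ 2 * rho x)%:E).
  apply/measurable_EFinP; apply: measurable_funM; last exact: mrho.
  exact: measurable_funX.
apply/integrableP; split; first exact: mur.
apply: le_lt_trans (energy_lty ka); apply: ge0_le_integral => //.
- exact: measurableT_comp.
- exact: menergy.
- move=> x _; rewrite /= lee_fin ger0_norm; last by rewrite mulr_ge0 ?sqr_ge0// ltW.
  by rewrite ler_wpM2r// ltW.
Qed.

Let L2r k : (k <= alpha)%N -> weighted_L2 rho (fr k).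
Proof.
move=> ka; apply: (component_L2 ka (mr ka)) => x.
by rewrite normc_sqr lerDl sqr_ge0.
Qed.

Let L2i k : (k <= alpha)%N -> weighted_L2 rho (fi k).
Proof.
move=> ka; apply: (component_L2 ka (mi ka)) => x.
by rewrite normc_sqr lerDr sqr_ge0.
Qed.

Let gr t : Re (g t) = Re (f (mobius c t)) * rho (mobius c t) * derive1 (mobius c) t.
Proof. by rewrite /g /mobius_pullback !Re_mulrc. Qed.

Let gi t : Im (g t) = Im (f (mobius c t)) * rho (mobius c t) * derive1 (mobius c) t.
Proof. by rewrite /g /mobius_pullback !Im_mulrc. Qed.

Let dgr n : (n <= alpha)%N ->
  real_weak_deriv circle_dom n (fun t => Re (g t)) (circle_pull c rho fr n).
Proof.
move=> na; rewrite (funext gr : (fun t => Re (g t)) = _).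
exact: (circle_pull_weak_deriv hc hrho (continuous_Re hfc) L2r wr).
Qed.

Let dgi n : (n <= alpha)%N ->
  real_weak_deriv circle_dom n (fun t => Im (g t)) (circle_pull c rho fi n).
Proof.
move=> na; rewrite (funext gi : (fun t => Im (g t)) = _).
exact: (circle_pull_weak_deriv hc hrho (continuous_Im hfc) L2i wi).
Qed.

Lemma pullback_has_weak_deriv n : (n <= alpha)%N ->
  exists h, weak_deriv circle_dom n g h.
Proof.
move=> na; exists (fun t => circle_pull c rho fr n t +i* circle_pull c rho fi n t).
by apply/weak_derivP; split; [exact: dgr|exact: dgi].
Qed.

Lemma pullback_measurable :
  measurable_fun circle_dom (fun t => Re (g t)) /\
  measurable_fun circle_dom (fun t => Im (g t)).
Proof.
by have [[mR _ _] _ _] := dgr (leq0n alpha); have [[mI _ _] _ _] := dgi (leq0n alpha).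
Qed.

(** Any weak derivative w is almost everywhere the pulled-back one, whose norm
    is computed on the line and bounded there by the hypothesis on D, a
    constant as in [pull_bound]. *)
Lemma circle_energy_le n (D : R) (w : R -> R[i]) : (n <= alpha)%N -> 0 <= D ->
  (forall h x, pull c rho n h x ^+ 2 * mobius_inv' c x <=
    D * \sum_(k < n.+1) h k x ^+ 2 * rho x) ->
  weak_deriv circle_dom n g w ->
  (\int[mu]_(t in circle_dom) (normc (w t) `^ 2)%:E <= D%:E * total_energy)%E.
Proof.
move=> na D0 HD /weak_derivP[wR wI].
have [_ [mwR _ _] _] := wR; have [_ [mwI _ _] _] := wI.
have mkr := measurable_circle_pull hc hrho L2r na.
have mki := measurable_circle_pull hc hrho L2i na.
have mC : measurable (circle_dom : set (measurableTypeR R)) by exact: measurable_circle_dom.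
pose k2 t := circle_pull c rho fr n t ^+ 2 + circle_pull c rho fi n t ^+ 2.
have mk2 : measurable_fun circle_dom (EFin \o k2).
  by apply/measurable_EFinP; apply: measurable_funD; exact: measurable_funX.
have k20 t : circle_dom t -> (0 <= (EFin \o k2) t)%E.
  by move=> _; rewrite lee_fin addr_ge0// sqr_ge0.
have -> : (\int[mu]_(t in circle_dom) (normc (w t) `^ 2)%:E =
    \int[mu]_(t in circle_dom) (EFin \o k2) t)%E.
{ apply: ae_eq_integral => //.
  - apply/measurable_EFinP.
    apply: (eq_measurable_fun (fun t => Re (w t) ^+ 2 + Im (w t) ^+ 2)).
      by move=> t _; rewrite normc_sqr.
    by apply: measurable_funD; exact: measurable_funX.
  - have nRI := negligibleU (real_weak_deriv_ae wR (dgr na)) (real_weak_deriv_ae wI (dgi na)).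
    apply: negligibleS nRI => t /= /not_implyP[Ct ne].
    apply: contrapT => /not_orP[/contrapT hR /contrapT hI]; apply: ne.
    by rewrite normc_sqr hR ?hI. }
rewrite (ge0_integral_circle hc mk2 k20).
have mS : measurable_fun setT
    (fun x => (\sum_(k < n.+1) (normc (fk k x) `^ 2 * rho x)%:E)%E).
  apply: (emeasurable_sum _ (h := fun (k : 'I_n.+1) x => (normc (fk k x) `^ 2 * rho x)%:E)) => k.
  apply: menergy.
  by rewrite (leq_trans _ na)// -ltnS.
have S0 x : (0 <= \sum_(k < n.+1) (normc (fk k x) `^ 2 * rho x)%:E)%E.
  by apply: sume_ge0 => k _; rewrite lee_fin mulr_ge0 ?powR_ge0// ltW.
apply: (@le_trans _ _ (\int[mu]_x
    (D%:E * \sum_(k < n.+1) (normc (fk k x) `^ 2 * rho x)%:E))%E).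
{ apply: ge0_le_integral => //.
  - move=> x _; rewrite -EFinM lee_fin mulr_ge0// ?addr_ge0 ?sqr_ge0//.
    by rewrite ltW// mobius_inv'_gt0.
  - apply: emeasurable_funM.
    + by apply/measurable_EFinP; apply: measurable_circle_comp => //; exact/measurable_EFinP.
    + by apply/measurable_EFinP; exact: measurable_mobius_inv'.
  - by apply: emeasurable_funM => //; exact: measurable_cst.
  - move=> x _; rewrite sumEFin -!EFinM lee_fin /k2 mulrDl.
    rewrite /circle_pull !(mobius_invK hc).
    apply: le_trans (lerD (HD fr x) (HD fi x)) _.
    rewrite -mulrDr -big_split/=; apply: ler_wpM2l => //; apply: ler_sum => k _.
    by rewrite -mulrDl normc_sqr. }
rewrite ge0_integralZl_EFin//; apply: lee_wpmul2l; first by rewrite lee_fin.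
apply: le_trans (sum_energy_le na).
rewrite big_mkord ge0_integral_sum//.
- move=> k; apply: menergy.
  by rewrite (leq_trans _ na)// -ltnS.
- move=> k x _; by rewrite lee_fin mulr_ge0 ?powR_ge0// ltW.
Qed.

(** The real and imaginary parts of h are the primitives from 0 of the parts
    of the pulled-back derivative of order n + 1. *)
Lemma pullback_boundary n : (n < alpha)%N -> exists h : R -> R[i],
  [/\ weak_deriv circle_dom n g h,
      {within `[0, (2 * pi)], continuous h},
      {in circle_dom, continuous h},
      h 0 = 0 /\ h (2 * pi) = 0 &
      h t @[t --> 0^'+] --> 0 /\ h t @[t --> (2 * pi)^'-] --> 0].
Proof.
move=> na.
have jr := circle_pull_rintegrable hc hrho L2r na.
have ji := circle_pull_rintegrable hc hrho L2i na.
pose u := primitive (circle_pull c rho fr n.+1).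
pose v := primitive (circle_pull c rho fi n.+1).
exists (fun t => u t +i* v t); split.
- apply/weak_derivP; split.
  + rewrite (funext gr : (fun t => Re (g t)) = _).
    exact: (primitive_weak_deriv hc hrho (continuous_Re hfc) L2r wr na).
  + rewrite (funext gi : (fun t => Im (g t)) = _).
    exact: (primitive_weak_deriv hc hrho (continuous_Im hfc) L2i wi na).
- move=> x; apply: cvg_complex; exact: primitive_within.
- move=> x hx; apply: cvg_complex; exact: primitive_in_continuous.
- split; first by rewrite /u /v !primitive0.
  by rewrite /u /v (primitive_pull2pi hc hrho L2r wr na) (primitive_pull2pi hc hrho L2i wi na).
- split; first by apply: cvg_complex; exact: primitive_cvg0.
  apply: cvg_complex.
    exact: (primitive_pull_cvg2pi hc hrho L2r wr na).
  exact: (primitive_pull_cvg2pi hc hrho L2i wi na).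
Qed.

(** Finiteness of the norm of g itself is the case n = 0 of
    [circle_energy_le], as g is its own weak derivative of order 0. *)
Lemma pullback_sobolev_per : sobolev_per alpha 2 g.
Proof.
have en n w : (n <= alpha)%N -> weak_deriv circle_dom n g w ->
    (\int[mu]_(t in circle_dom) (normc (w t) `^ 2)%:E < +oo)%E.
  move=> na ww; have [D D0 HD] := pull_bound hc hrho n.
  apply: le_lt_trans (circle_energy_le na D0 HD ww) _.
  by rewrite lte_mul_pinfty// ?lee_fin// total_energy_lty.
have g0 : weak_deriv circle_dom 0 g g.
  have [_ [h [lg _ _]]] := (pullback_measurable, pullback_has_weak_deriv (leq0n alpha)).
  by split => // psi _; rewrite expr0 mul1r derive1n0.
split.
- exact: pullback_measurable.
- by rewrite /Lq_norm; apply: poweR_lty; exact: en g0.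
- exact: pullback_has_weak_deriv.
- rewrite big_mkord; apply: lte_sum_pinfty => k _.
  have ka : (k <= alpha)%N by rewrite -ltnS.
  by apply: (en k) => //; apply: wderivP; exact: pullback_has_weak_deriv.
- by move=> t ta; have [h [wh ch _ [h0 h2pi] _]] := pullback_boundary ta; exists h; rewrite h0 h2pi.
Qed.

Lemma pullback_Lq_norm_le n D : (n <= alpha)%N -> 0 <= D ->
  (forall h x, pull c rho n h x ^+ 2 * mobius_inv' c x <=
    D * \sum_(k < n.+1) h k x ^+ 2 * rho x) ->
  (Lq_norm 2 circle_dom (wderiv circle_dom n g) <=
    (D `^ 2^-1)%:E * sobolev_norm alpha 2 rho f)%E.
Proof.
move=> na D0 HD.
have ww := wderivP (pullback_has_weak_deriv na).
have T0 : (0 <= total_energy)%E by apply: sume_ge0 => k _; exact: energy_ge0.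
rewrite -poweR_EFin -poweRM// ?lee_fin//.
have E0 : (0 <= \int[mu]_(t in circle_dom)
    (normc (wderiv circle_dom n g t) `^ 2)%:E)%E.
  by apply: integral_ge0 => t _; rewrite lee_fin powR_ge0.
apply: gt0_ler_poweR; rewrite ?in_itv/= ?leey ?andbT ?invr_ge0//.
- by rewrite mule_ge0// lee_fin.
- exact: (circle_energy_le na D0 HD ww).
Qed.

End ComplexPullback.

Theorem lemma3p2 (R : realType) (c : R) (hc : 0 < c)
    (rho : R -> R) (hrho : schwartz_mon rho) :
  exists2 C : nat -> R, (forall t, 0 < C t) &
  forall (alpha : nat) (halpha : (0 < alpha)%N)
    (f : R -> R[i]) (hf : sobolev alpha 2 rho f) (hfc : continuous f),
  let g := mobius_pullback c rho f in
  [/\ forall t, (t <= alpha)%N ->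
        (exists h, weak_deriv circle_dom t g h) /\
        (Lq_norm 2 circle_dom (wderiv circle_dom t g)
           <= (C t)%:E * sobolev_norm alpha 2 rho f)%E,
      forall t, (t < alpha)%N -> exists h : R -> R[i],
        [/\ weak_deriv circle_dom t g h,
            {in circle_dom, continuous h},
            h theta @[theta --> 0^'+] --> 0 &
            h theta @[theta --> (2 * pi)^'-] --> 0] &
      sobolev_per alpha 2 g].
Proof.
have bound n : {D : R | 0 <= D /\ forall h x,
    pull c rho n h x ^+ 2 * mobius_inv' c x <=
    D * \sum_(k < n.+1) h k x ^+ 2 * rho x}.
  by apply: cid; have [D D0 HD] := pull_bound hc hrho n; exists D.
pose D n := projT1 (bound n).
exists (fun n => D n `^ 2^-1 + 1).
  by move=> n; rewrite ltr_wpDl ?powR_ge0.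
move=> alpha halpha f hf hfc g; split.
- move=> n na; split; first exact: (pullback_has_weak_deriv hc hrho hf hfc na).
  have [D0 HD] := projT2 (bound n).
  apply: le_trans (pullback_Lq_norm_le hc hrho hf hfc na D0 HD) _.
  apply: lee_wpmul2r; first exact: poweR_ge0.
  by rewrite lee_fin lerDl.
- move=> n na; have [h [wh _ ch _ [h0 h2pi]]] := pullback_boundary hc hrho hf hfc na.
  by exists h.
- exact: (pullback_sobolev_per hc hrho hf hfc).
Qed.
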